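(* Let $m,n\in\mathbb{N}$ with $m\le n$. (Wasserstein metric.) Let $p\in[1,\infty]$. For all $\mu\in \mathrm{M}^p(\mathbb{R}^m)$ and $\nu\in \mathrm{M}^p(\mathbb{R}^n)$, $$\inf_{\beta\in\Phi^-(\nu,m)} \mathrm{W}_p(\mu,\beta)=\inf_{\alpha\in\Phi^+_p(\mu,n)} \mathrm{W}_p(\alpha,\nu).$$ ($f$-divergence.) Let $f:\mathbb{R}\to\mathbb{R}$ be convex with $f(1)=0$. For all $\mu\in \mathrm{M}_d(\mathbb{R}^m)$ and $\nu\in \mathrm{M}_{pd}(\mathbb{R}^n)$, $$\inf_{\beta\in\Phi^-(\nu,m)} \mathrm{D}_f(\mu\Vert\beta)=\inf_{\alpha\in\Phi^+_d(\mu,n)} \mathrm{D}_f(\alpha\Vert\nu).$$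
   Context: $\mathrm{M}(\mathbb{R}^n)$ is the set of Borel probability measures on $\mathbb{R}^n$. $\mathrm{M}^p(\mathbb{R}^n)\subseteq \mathrm{M}(\mathbb{R}^n)$ is the subset of those with finite $p$th moment, $\int\|x\|_2^p\,d\mu(x)<\infty$ (for $p=\infty$: the $\mu$-essential supremum of $\|x\|_2$ is finite). $\mathrm{M}_d(\mathbb{R}^n)$ is the set of $\mu\in \mathrm{M}(\mathbb{R}^n)$ having a density with respect to Lebesgue measure, and $\mathrm{M}_{pd}(\mathbb{R}^n)$ the set of those having a strictly positive density. For $m\le n$, $\mathrm{O}(m,n)=\{V\in\mathbb{R}^{m\times n}: VV^{T}=I_m\}$. For $V\in \mathrm{O}(m,n)$, $b\in\mathbb{R}^m$, $\varphi_{V,b}:\mathbb{R}^n\to\mathbb{R}^m$ is $\varphi_{V,b}(x)=Vx+b$, and for $\mu\in \mathrm{M}(\mathbb{R}^n)$, $\varphi_{V,b}(\mu)=\mu\circ\varphi_{V,b}^{-1}\in \mathrm{M}(\mathbb{R}^m)$ is the pushforward measure. For $\nu\in \mathrm{M}(\mathbb{R}^n)$ and $\mu\in \mathrm{M}(\mathbb{R}^m)$, the projections of $\nu$ are $$\Phi^-(\nu,m)=\{\beta\in \mathrm{M}(\mathbb{R}^m): \varphi_{V,b}(\nu)=\beta \text{ for some } V\in \mathrm{O}(m,n),\ b\in\mathbb{R}^m\},$$ and the embeddings of $\mu$ with finite $p$th moment, respectively with a density, are $$\Phi^+_p(\mu,n)=\{\alpha\in \mathrm{M}^p(\mathbb{R}^n):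 \varphi_{V,b}(\alpha)=\mu \text{ for some } V\in \mathrm{O}(m,n),\ b\in\mathbb{R}^m\},$$ $$\Phi^+_d(\mu,n)=\{\alpha\in \mathrm{M}_d(\mathbb{R}^n): \varphi_{V,b}(\alpha)=\mu \text{ for some } V\in \mathrm{O}(m,n),\ b\in\mathbb{R}^m\}.$$ For $\mu,\nu\in \mathrm{M}^p(\mathbb{R}^n)$, the $p$-Wasserstein metric is $$\mathrm{W}_p(\mu,\nu)=\Bigl[\inf_{\gamma\in\Gamma(\mu,\nu)}\int_{\mathbb{R}^{2n}}\|x-y\|_2^p\,d\gamma(x,y)\Bigr]^{1/p},$$ where $\Gamma(\mu,\nu)$ is the set of couplings of $\mu$ and $\nu$ (Borel probability measures on $\mathbb{R}^n\times\mathbb{R}^n$ with marginals $\mu$ and $\nu$); for $p=\infty$ the bracketed expression is replaced by the infimum over couplings of the $\gamma$-essential supremum of $\|x-y\|_2$. For $f:\mathbb{R}\to\mathbb{R}$ convex with $f(1)=0$ and $\mu$ absolutely continuous with respect to $\nu$, the $f$-divergence is $\mathrm{D}_f(\mu\Vert\nu)=\int f\bigl(\tfrac{d\mu}{d\nu}\bigr)\,d\nu$ (possibly $+\infty$), where $\tfrac{d\mu}{d\nu}$ is the Radon–Nikodym derivative. *)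

(* Defs.v *)
From HB Require Import structures.
From mathcomp Require Import all_boot all_order all_algebra.
From mathcomp Require Import all_classical all_reals all_analysis.
From mathcomp Require Import measurable_realfun ess_sup_inf.

Set Implicit Arguments.
Unset Strict Implicit.
Unset Printing Implicit Defensive.

Import Order.TTheory GRing.Theory Num.Theory.
Import numFieldNormedType.Exports.

Local Open Scope classical_set_scope.
Local Open Scope ring_scope.

Definition Rn (R : realType) n := g_sigma_algebraType (@open 'cV[R]_n).
HB.instance Definition _ (R : realType) n := Measurable.on (Rn R n).

Section lebesgue_Rn.
Context {R : realType}.

Definition cons_Rn n (tx : measurableTypeR R * Rn R n) : Rn R n.+1 :=
  col_mx (tx.1%:M : 'cV[R]_1) tx.2.

(* Iterated product of the one-dimensional Lebesgue measure, unit mass on the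
   point R^0; its value on boxes is [lebesgue_Rn_box]. *)
Fixpoint lebesgue_Rn n : set (Rn R n) -> \bar R :=
  match n with
  | 0 => @dirac _ (Rn R 0) 0 R
  | n'.+1 => pushforward (lebesgue_measure \x @lebesgue_Rn n')%E (@cons_Rn n')
  end.

Lemma measurable_coord n (i : 'I_n) :
  measurable_fun setT ((fun x : 'cV[R]_n => x i 0) : Rn R n -> measurableTypeR R).
Proof.
apply: (measurability _ (RGenOpens.measurableE R)) => _ [_ [a [b ->]] <-].
rewrite setTI; apply: sub_sigma_algebra.
apply: open_comp; last exact: interval_open.
by move=> x _; exact: coord_continuous.
Qed.


Lemma open_Rn_bigcup n (U : set 'cV[R]_n) : open U ->
  U = \bigcup_(qk in [set qk : 'cV[rat]_n * nat |
      [set x : 'cV[R]_n | forall i, `|ratr (qk.1 i 0) - x i 0| < qk.2.+1%:R^-1]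
        `<=` U])
    [set x : 'cV[R]_n | forall i, `|ratr (qk.1 i 0) - x i 0| < qk.2.+1%:R^-1].
Proof.
move=> oU; apply/seteqP; split => [x Ux|x [qk /= qkU]]; last exact: qkU.
move: oU; rewrite openE => /(_ _ Ux)/nbhs_ballP[e /= e0 xeU].
have [k ke] : exists k, k.+1%:R^-1 < e / 2 :> R.
  exists (Num.truncn (e / 2)^-1); rewrite invf_plt ?posrE ?divr_gt0//.
  by rewrite truncnS_gt.
have k0 : 0 < k.+1%:R^-1 :> R by rewrite invr_gt0.
have /choice[q qx] (i : 'I_n) : exists q : rat, `|ratr q - x i 0| < k.+1%:R^-1.
  have /rat_in_itvoo[q] : x i 0 < x i 0 + k.+1%:R^-1 by rewrite ltrDl.
  rewrite in_itv/= => /andP[xq qx]; exists q.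
  by rewrite gtr0_norm ?subr_gt0// ltrBlDl.
exists (\col_i q i, k) => /= [y qy|i]; last by rewrite mxE.
apply: xeU; split => // i j; rewrite !ord1 /ball/=.
rewrite (le_lt_trans (ler_distD (ratr (q i)) _ _))// (splitr e).
by rewrite ltrD ?(lt_trans _ ke)// 1?distrC// distrC; have := qy i; rewrite mxE.
Qed.

Lemma measurable_fun_RnP d (T : measurableType d) n (f : T -> Rn R n) :
  (forall i, measurable_fun setT
    ((fun t => (f t : 'cV[R]_n) i 0) : T -> measurableTypeR R)) ->
  measurable_fun setT f.
Proof.
move=> mf; apply: (@measurability _ _ T (Rn R n) setT f (@open 'cV[R]_n) erefl) => _ [U oU <-].
rewrite setTI (open_Rn_bigcup oU) preimage_bigcup bigcup_mkcond.
apply: countable_bigcupT_measurable => //.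
move=> -[q k]; case: ifPn => // _.
rewrite (_ : _ @^-1` _ = \big[setI/setT]_(i : 'I_n)
    ((fun t => (f t : 'cV[R]_n) i 0) @^-1` ball (ratr (q i 0) : R) k.+1%:R^-1)).
  apply: bigsetI_measurable => i _; rewrite -[X in measurable X]setTI.
  by apply: mf => //; exact: measurable_ball.
rewrite -bigcap_seq; apply/seteqP; split => t /=.
  by move=> + i _; apply.
by move=> + i; apply; rewrite /= mem_index_enum.
Qed.

Lemma measurable_cons_Rn n : measurable_fun setT (@cons_Rn n).
Proof.
apply: measurable_fun_RnP => i; rewrite /cons_Rn.
have [j ->|j ->] := fintype.split_ordP (i : 'I_(1 + n)).
  rewrite ord1; under eq_fun do rewrite (@col_mxEu R 1 n 1) mxE eqxx.
  exact: measurable_fst.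
under eq_fun do rewrite (@col_mxEd R 1 n 1).
by apply: (measurableT_comp (measurable_coord j)); exact: measurable_snd.
Qed.

HB.instance Definition _ n := isMeasurableFun.Build _ _ _ _ (@cons_Rn n)
  (@measurable_cons_Rn n).

Let uncons_Rn n (x : Rn R n.+1) : measurableTypeR R * Rn R n :=
  ((x : 'cV[R]_(1 + n)) 0 0, dsubmx (x : 'cV[R]_(1 + n))).

Let measurable_uncons_Rn n : measurable_fun setT (@uncons_Rn n).
Proof.
apply/measurable_fun_pairP; split; first exact: (@measurable_coord n.+1 0).
apply: measurable_fun_RnP => i /=.
under eq_fun do rewrite mxE.
exact: (@measurable_coord n.+1 (rshift 1 i)).
Qed.

Let cons_RnK n : cancel (@cons_Rn n) (@uncons_Rn n).
Proof.
move=> [t x]; rewrite /uncons_Rn /cons_Rn col_mxKd; congr (_, _).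
rewrite (_ : 0 = lshift n (0 : 'I_1)); last exact/val_inj.
by rewrite (@col_mxEu R 1 n 1) mxE eqxx.
Qed.

Let sigma_finite_measure_ex d (T : measurableType d) (nu : set T -> \bar R) :
  nu set0 = 0%E -> (forall A, 0 <= nu A)%E -> semi_sigma_additive nu ->
  sigma_finite setT nu ->
  exists m : {sigma_finite_measure set T -> \bar R}, m = nu :> (set _ -> \bar R).
Proof.
move=> nu0 nu_ge0 nu_sigma nu_sf.
have nuM := isMeasure.Build _ _ _ nu nu0 nu_ge0 nu_sigma.
pose nuM' : {measure set T -> \bar R} := HB.pack nu nuM.
have nuS := Measure_isSigmaFinite.Build _ _ _ nuM' nu_sf.
by exists (HB.pack nu nuM nuS : {sigma_finite_measure set T -> \bar R}).
Qed.

Let lebesgue_RnE n : exists m : {sigma_finite_measure set (Rn R n) -> \bar R},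
  m = @lebesgue_Rn n :> (set _ -> \bar R).
Proof.
elim: n => [|n [m mE]]; first by exists (@dirac _ (Rn R 0) 0 R).
rewrite /= -mE.
pose mu : {measure set (measurableTypeR R * Rn R n)%type -> \bar R} :=
  (lebesgue_measure \x m)%E.
have pm0 : pushforward mu (@cons_Rn n) set0 = 0%E.
  by rewrite /pushforward preimage_set0 measure0.
have pm_ge0 A : (0 <= pushforward mu (@cons_Rn n) A)%E by exact: measure_ge0.
have pm_sigma : semi_sigma_additive (pushforward mu (@cons_Rn n)).
  exact: measure_semi_sigma_additive.
have pm_sf : sigma_finite setT (pushforward mu (@cons_Rn n)).
  have /sigma_finiteP[F [FT ndF Foo]] := sigma_finiteT (@lebesgue_measure R).
  have /sigma_finiteP[G [GT ndG Goo]] := sigma_finiteT m.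
  exists (fun k => @uncons_Rn n @^-1` (F k `*` G k)).
    rewrite -preimage_bigcup (_ : \bigcup_i _ = setT) ?preimage_setT//.
    apply/seteqP; split => // -[t x] _.
    have [i _ Fi] : (\bigcup_i F i) t by rewrite -FT.
    have [j _ Gj] : (\bigcup_i G i) x by rewrite -GT.
    exists (maxn i j) => //; split => /=.
      by move: Fi; exact/subsetPset/ndF/leq_maxl.
    by move: Gj; exact/subsetPset/ndG/leq_maxr.
  move=> k; have [mF Fk] := Foo k; have [mG Gk] := Goo k; split.
    rewrite -[X in measurable X]setTI; apply: measurable_uncons_Rn => //.
    exact: measurableX.
  rewrite /pushforward (_ : _ @^-1` _ = F k `*` G k); last first.
    have uc : @uncons_Rn n \o @cons_Rn n = id.
      by apply/funext => x; exact: cons_RnK.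
    by rewrite -comp_preimage uc preimage_id.
  by rewrite [ltLHS]product_measure1E// lte_mul_pinfty// ge0_fin_numE.
exact: sigma_finite_measure_ex.
Qed.

Let lebesgue_Rn0 n : @lebesgue_Rn n set0 = 0%E.
Proof. by have [m <-] := lebesgue_RnE n; exact: measure0. Qed.

Let lebesgue_Rn_ge0 n A : (0 <= @lebesgue_Rn n A)%E.
Proof. by have [m <-] := lebesgue_RnE n; exact: measure_ge0. Qed.

Let lebesgue_Rn_sigma_additive n : semi_sigma_additive (@lebesgue_Rn n).
Proof.
by have [m <-] := lebesgue_RnE n; exact: measure_semi_sigma_additive.
Qed.

HB.instance Definition _ n := isMeasure.Build _ _ _ (@lebesgue_Rn n)
  (@lebesgue_Rn0 n) (@lebesgue_Rn_ge0 n) (@lebesgue_Rn_sigma_additive n).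

Let lebesgue_Rn_sigma_finite n : sigma_finite setT (@lebesgue_Rn n).
Proof. by have [m <-] := lebesgue_RnE n; exact: sigma_finiteT. Qed.

HB.instance Definition _ n := Measure_isSigmaFinite.Build _ _ _ (@lebesgue_Rn n)
  (@lebesgue_Rn_sigma_finite n).

Lemma measurable_Rn_box n (a b : 'cV[R]_n) :
  measurable ([set x | forall i, a i 0 < (x : 'cV[R]_n) i 0 <= b i 0] : set (Rn R n)).
Proof.
rewrite (_ : mkset _ = \big[setI/setT]_(i : 'I_n)
    ((fun x : 'cV[R]_n => x i 0) @^-1` `]a i 0, b i 0])).
  apply: bigsetI_measurable => i _; rewrite -[X in measurable X]setTI.
  by apply: measurable_coord => //; exact: measurable_itv.
rewrite -bigcap_seq; apply/seteqP; split => x /=.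
  by move=> + i _; rewrite /= in_itv; apply.
by move=> + i => /(_ i); rewrite /= in_itv; apply; rewrite mem_index_enum.
Qed.

Lemma lebesgue_Rn_box n (a b : 'cV[R]_n) : (forall i, a i 0 <= b i 0) ->
  lebesgue_Rn [set x | forall i, a i 0 < (x : 'cV[R]_n) i 0 <= b i 0] =
  (\prod_i (b i 0 - a i 0))%:E.
Proof.
elim: n a b => [|n IH] a b ab.
  by rewrite big_ord0 /= diracE mem_set// => -[].
rewrite big_ord_recl.
pose a' : 'cV[R]_n := \col_i a (lift 0 i) 0.
pose b' : 'cV[R]_n := \col_i b (lift 0 i) 0.
rewrite (_ : \prod_(i < n) _ = \prod_(i < n) (b' i 0 - a' i 0)); last first.
  by apply: eq_bigr => i _; rewrite !mxE.
rewrite EFinM -IH; last by move=> i; rewrite !mxE.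
rewrite /= /pushforward.
rewrite (_ : _ @^-1` _ = `]a 0 0, b 0 0] `*`
    [set x | forall i, a' i 0 < (x : 'cV[R]_n) i 0 <= b' i 0]).
  rewrite [LHS]product_measure1E//; last exact: measurable_Rn_box.
  congr (_ * _)%E; rewrite [LHS]lebesgue_measure_itv/= lte_fin.
  by case: ltgtP (ab 0) => // -> _; rewrite subrr.
have c0 t x : (cons_Rn (t, x) : 'cV[R]_n.+1) 0 0 = t.
  by have [] := cons_RnK (t, x).
have cS t x i : (cons_Rn (t, x) : 'cV[R]_n.+1) (lift 0 i) 0 = (x : 'cV[R]_n) i 0.
  rewrite (_ : lift 0 i = rshift 1 i); last exact/val_inj.
  exact: (@col_mxEd R 1 n 1).
apply/seteqP; split => -[t x] /=.
  move=> abx; split; first by have := abx 0; rewrite c0 in_itv.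
  by move=> i; have := abx (lift 0 i); rewrite cS !mxE.
move=> [+ abx] i; rewrite in_itv/= => abt.
by case: (unliftP 0 i) => [j|] ->; [have := abx j; rewrite cS !mxE|rewrite c0].
Qed.

End lebesgue_Rn.
Arguments lebesgue_Rn {R} n.

Section measures_on_Rn.
Context {R : realType}.
Local Open Scope ereal_scope.

Definition norm2 n (x : 'cV[R]_n) : R := Num.sqrt (\sum_i x i 0 ^+ 2)%R.

(* Measures are total functions on sets, unconstrained outside the
   sigma-algebra: they are compared on measurable sets only. *)
Definition eq_measure d (T : measurableType d) (mu nu : set T -> \bar R) :=
  forall A, measurable A -> mu A = nu A.

Definition finite_moment n (p : \bar R) : set (probability (Rn R n) R) :=
  [set mu : probability (Rn R n) R | match p with
            | r%:E => \int[mu]_x (norm2 x `^ r)%:E < +oo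
            | +oo => ess_sup mu (fun x => (norm2 x)%:E) < +oo
            | -oo => False
            end].

Definition is_density n (mu : probability (Rn R n) R) (g : Rn R n -> R) :=
  measurable_fun setT g /\
  eq_measure mu (fun A => \int[lebesgue_Rn n]_(x in A) (g x)%:E).

Definition has_density n : set (probability (Rn R n) R) :=
  [set mu : probability (Rn R n) R | exists g, (forall x, 0 <= g x)%R /\ is_density mu g].

Definition has_pos_density n : set (probability (Rn R n) R) :=
  [set mu : probability (Rn R n) R | exists g, (forall x, 0 < g x)%R /\ is_density mu g].

Definition orthomx m n : set 'M[R]_(m, n) := [set V | V *m V^T = 1%:M]%R.

Definition affine_Rn m n (V : 'M[R]_(m, n)) (b : 'cV[R]_m)
  (x : Rn R n) : Rn R m := (V *m x + b)%R.

Definition affine_image m n (nu : probability (Rn R n) R)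
    (beta : probability (Rn R m) R) :=
  exists V b, orthomx V /\ eq_measure (pushforward nu (affine_Rn V b)) beta.

Definition projections n (nu : probability (Rn R n) R) m :
    set (probability (Rn R m) R) :=
  [set beta | affine_image nu beta].

Definition embeddings_moment m (p : \bar R) (mu : probability (Rn R m) R) n :
    set (probability (Rn R n) R) :=
  [set alpha | finite_moment p alpha /\ affine_image alpha mu].

Definition embeddings_density m (mu : probability (Rn R m) R) n :
    set (probability (Rn R n) R) :=
  [set alpha | has_density alpha /\ affine_image alpha mu].

Definition couplings n (mu nu : probability (Rn R n) R) :
    set (probability (Rn R n * Rn R n)%type R) :=
  [set gamma : probability (Rn R n * Rn R n)%type R | eq_measure (pushforward gamma fst) mu /\
               eq_measure (pushforward gamma snd) nu].

Definition dist2 n (z : Rn R n * Rn R n) : R :=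
  norm2 ((z.1 : 'cV[R]_n) - z.2)%R.

(* Only used for 1 <= p and measures with finite p-th moment. *)
Definition wasserstein n (p : \bar R) (mu nu : probability (Rn R n) R) : \bar R :=
  match p with
  | r%:E => (ereal_inf [set \int[gamma]_z (dist2 z `^ r)%:E
                         | gamma in couplings mu nu]) `^ r^-1
  | +oo => ereal_inf [set ess_sup gamma (fun z => (dist2 z)%:E)
                       | gamma in couplings mu nu]
  | -oo => 0
  end.

(* Meaningful for mu `<< nu, where the Radon-Nikodym derivative is finite
   everywhere, so that [fine] loses nothing. *)
Definition fdivergence d (T : measurableType d) (f : R -> R)
    (mu nu : probability T R) : \bar R :=
  \int[nu]_x (f (fine (Radon_Nikodym (charge_of_finite_measure mu) nu x)))%:E.

End measures_on_Rn.
Arguments projections {R n} nu m.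
Arguments embeddings_moment {R m} p mu n.
Arguments embeddings_density {R m} mu n.

(* Main.v *)
Require Import Defs.
From HB Require Import structures.
From mathcomp Require Import all_boot all_order all_algebra.
From mathcomp Require Import all_classical all_reals all_analysis.
From mathcomp Require Import measurable_realfun ess_sup_inf.
From mathcomp Require Import zify ring lra.

(* Wasserstein distances. If V, b realise alpha |-> mu, a coupling of alpha and
   nu is pushed to a coupling of mu and beta = phi(nu) by the contraction
   phi = phi_(V, b). Conversely, if (x, y) is a coupling of mu and phi(nu) and
   w ~ nu has phi(w) = y, then w + V^T (x - phi(w)) lies over x, at distance
   |x - y| from w. Gluing w to (x, y) exactly needs a disintegration; as only
   infima are compared, it suffices that phi(w) and y fall in the same cell of a
   countable partition of small mesh, which needs conditioning on countably many
   events only. Minkowski's inequality controls the error.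

   f-divergences. For beta = phi(nu), the inequality
   D_f(phi(alpha) || beta) <= D_f(alpha || nu) is Jensen's inequality, obtained
   by integrating the subgradient inequality of f at (d mu / d beta) o phi. It is
   an equality for alpha = ((d mu / d beta) o phi) nu. This alpha exists because
   preimages under phi of non-null sets are non-null for the Lebesgue measure. *)

Set Implicit Arguments.
Unset Strict Implicit.
Unset Printing Implicit Defensive.

Import Order.TTheory GRing.Theory Num.Theory.
Import numFieldNormedType.Exports.
(* [orthomx] and [eq_measure] are also names of library constants. *)
Import Defs.

Local Open Scope classical_set_scope.
Local Open Scope ring_scope.
Local Open Scope ereal_scope.

(** * Gluing of probability measures *)

Lemma measurable_preimageT d1 d2 (T1 : measurableType d1) (T2 : measurableType d2)
    (f : T1 -> T2) (A : set T2) :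
  measurable_fun setT f -> measurable A -> measurable (f @^-1` A).
Proof. by move=> mf mA; rewrite -[X in measurable X]setTI; exact: mf. Qed.

Lemma pushforward_probability d1 d2 (T1 : measurableType d1)
    (T2 : measurableType d2) (R : realType) (P : probability T1 R)
    (f : T1 -> T2) : measurable_fun setT f ->
  exists Q : probability T2 R, Q = pushforward P f :> (set T2 -> \bar R).
Proof.
move=> mf; pose X : {mfun T1 >-> T2} := HB.pack f (isMeasurableFun.Build _ _ _ _ f mf).
by exists (distribution P X).
Qed.

Lemma measure_probability d (T : measurableType d) (R : realType)
    (m : {measure set T -> \bar R}) : m setT = 1 ->
  exists P : probability T R, P = m :> (set T -> \bar R).
Proof.
suff gen (nu : set T -> \bar R) : nu set0 = 0 -> (forall A, 0 <= nu A) ->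
    semi_sigma_additive nu -> nu setT = 1 ->
    exists P : probability T R, P = nu :> (set T -> \bar R).
  by apply: gen; [exact: measure0|exact: measure_ge0|
                  exact: measure_semi_sigma_additive].
move=> nu0 nu_ge0 nu_sigma nu1.
have nuM := isMeasure.Build _ _ _ nu nu0 nu_ge0 nu_sigma.
pose nuM' : {measure set T -> \bar R} := HB.pack nu nuM.
have nuP := Measure_isProbability.Build _ _ _ nuM' nu1.
by exists (HB.pack nu nuM nuP : probability T R).
Qed.

(* The conditionally independent coupling of [P] and [Q] given [u = v]. *)
Lemma glue_countable d1 d2 (X : measurableType d1) (Y : measurableType d2)
    (R : realType) (P : probability X R) (Q : probability Y R)
    (u : X -> nat) (v : Y -> nat) :
  measurable_fun setT u -> measurable_fun setT v ->
  (forall k, P (u @^-1` [set k]) = Q (v @^-1` [set k])) ->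
  exists T : probability (X * Y)%type R,
    [/\ forall A, measurable A -> T (fst @^-1` A) = P A,
        forall B, measurable B -> T (snd @^-1` B) = Q B &
        \forall z \ae T, u z.1 = v z.2].
Proof.
move=> mu mv PQ.
have mU k : measurable (u @^-1` [set k]) by exact: measurable_preimageT.
have mV k : measurable (v @^-1` [set k]) by exact: measurable_preimageT.
pose S k := (u @^-1` [set k]) `*` (v @^-1` [set k]).
have mS k : measurable (S k) by exact: measurableX.
have c0 k : (0 <= (fine (Q (v @^-1` [set k])))^-1)%R.
  by rewrite invr_ge0 fine_ge0.
(* On the cell [S k] the coupling is the product measure, normalised by the common mass of the two
   sides; a null cell gets weight 0, the inverse of 0 being 0. *)
pose M k : {measure set (X * Y) -> \bar R} :=
  mscale (NngNum (c0 k)) (mrestr (P \x Q) (mS k)).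
pose T : {measure set (X * Y) -> \bar R} := mseries M 0.
have ME k A B : measurable A -> measurable B ->
    M k (A `*` B) = (fine (Q (v @^-1` [set k])))^-1%:E *
      (P (A `&` u @^-1` [set k]) * Q (B `&` v @^-1` [set k])).
  move=> mA mB; rewrite /M /= /mscale /= /mrestr /S -setXI; congr (_ * _).
  by apply: product_measure1E; exact: measurableI.
(* A null cell causes no loss: there [x], being at most its mass, is 0 too. *)
have QK k (x : \bar R) : 0 <= x -> x <= Q (v @^-1` [set k]) ->
    (fine (Q (v @^-1` [set k])))^-1%:E * (x * Q (v @^-1` [set k])) = x.
  have Qf : Q (v @^-1` [set k]) \is a fin_num by exact: fin_num_measure.
  have [->|Q0] := eqVneq (Q (v @^-1` [set k])) 0.
    by move=> x0 x1; rewrite !mule0; apply/eqP; rewrite eq_le x0 x1.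
  move=> x0 xQ; rewrite muleC -muleA -[in X in x * (X * _)](fineK Qf) -EFinM divff ?mule1//.
  by rewrite fine_eq0.
have sumU d (Z : measurableType d) (m : probability Z R) (w : Z -> nat) C :
    (forall k, measurable (w @^-1` [set k])) -> measurable C ->
    \sum_(0 <= k <oo) m (C `&` w @^-1` [set k]) = m C.
  move=> mw mC; rewrite -[in RHS](setIT C).
  have <- : \bigcup_k (w @^-1` [set k]) = setT.
    by apply/seteqP; split => // z _; exists (w z).
  rewrite setI_bigcupr measure_semi_bigcup//.
  - by move=> k; exact: measurableI.
  - apply: trivIset_setIl; apply/trivIsetP => i j _ _ ij.
    by apply/seteqP; split => // z [/= zi zj]; move: ij; rewrite -zi -zj eqxx.
  - by apply: bigcup_measurable => k _; exact: measurableI.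
have TX A : measurable A -> T (fst @^-1` A) = P A.
  move=> mA; rewrite -[RHS](sumU _ _ P u _ mU mA); apply: eq_eseriesr => k _.
  rewrite (_ : fst @^-1` A = A `*` setT); last first.
    by apply/seteqP; split => -[x y]//= [].
  rewrite ME// setTI QK// -PQ le_measure ?inE//; exact: measurableI.
have TY B : measurable B -> T (snd @^-1` B) = Q B.
  move=> mB; rewrite -[RHS](sumU _ _ Q v _ mV mB); apply: eq_eseriesr => k _.
  rewrite (_ : snd @^-1` B = setT `*` B); last first.
    by apply/seteqP; split => -[x y]//= [].
  rewrite ME// setTI PQ [X in _ * X]muleC QK// le_measure ?inE//; exact: measurableI.
have T1 : T setT = 1 by rewrite -(preimage_setT fst) TX// probability_setT.
have [T' T'E] := measure_probability T1.
(* Each [M k] is carried by [S k], on which [u] and [v] agree, so the complement of the union of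
   these cells is null. *)
have mN : measurable (~` \bigcup_k S k).
  by apply: measurableC; exact: bigcup_measurable.
have TN : T (~` \bigcup_k S k) = 0.
  rewrite /T/= /mseries eseries0// => k _ _.
  rewrite /M/= /mscale /= /mrestr (_ : _ `&` _ = set0) ?measure0 ?mule0//.
  by apply/seteqP; split => // z [/= nS Sz]; apply: nS; exists k.
exists T'; split; rewrite ?T'E//; exists (~` \bigcup_k S k); split => //.
by move=> [x y] /= uv [k _ [/= xk yk]]; apply: uv; rewrite xk yk.
Qed.

(** * Euclidean geometry *)

Section euclidean_norm.
Context {R : realType}.
Local Open Scope ring_scope.

Lemma norm2_ge0 n (x : 'cV[R]_n) : 0 <= norm2 x.
Proof. exact: sqrtr_ge0. Qed.

Lemma sqr_norm2 n (x : 'cV[R]_n) : norm2 x ^+ 2 = \sum_i x i 0 ^+ 2.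
Proof. by rewrite sqr_sqrtr// sumr_ge0// => i _; exact: sqr_ge0. Qed.

Lemma sqr_norm2_mx n (x : 'cV[R]_n) : norm2 x ^+ 2 = (x^T *m x) 0 0.
Proof. by rewrite sqr_norm2 mxE; apply: eq_bigr => i _; rewrite mxE expr2. Qed.

Lemma norm2_coord n (x : 'cV[R]_n) i : `|x i 0| <= norm2 x.
Proof.
rewrite -sqrtr_sqr ler_wsqrtr// (bigD1 i)//= lerDl sumr_ge0// => j _.
exact: sqr_ge0.
Qed.

Lemma norm2N n (x : 'cV[R]_n) : norm2 (- x) = norm2 x.
Proof.
by rewrite /norm2; congr Num.sqrt; apply: eq_bigr => i _; rewrite mxE sqrrN.
Qed.

Lemma norm2_cauchy_schwarz n (x y : 'cV[R]_n) :
  \sum_i x i 0 * y i 0 <= norm2 x * norm2 y.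
Proof.
set s := norm2 x; set t := norm2 y.
have [s0|s0] := eqVneq s 0.
  rewrite s0 mul0r big1// => i _; apply/eqP; rewrite mulf_eq0; apply/orP; left.
  by rewrite -normr_le0 -s0 norm2_coord.
have [t0|t0] := eqVneq t 0.
  rewrite t0 mulr0 big1// => i _; apply/eqP; rewrite mulf_eq0; apply/orP; right.
  by rewrite -normr_le0 -t0 norm2_coord.
have st_gt0 : 0 < s * t by rewrite mulr_gt0// lt_neqAle eq_sym ?s0 ?t0 norm2_ge0.
(* As [s] and [t] are the norms, the expansion is twice [(s * t) ^+ 2] minus [s * t] times the inner
   product; division by [s * t] concludes. *)
have : 0 <= \sum_i (t * x i 0 - s * y i 0) ^+ 2.
  by rewrite sumr_ge0// => i _; exact: sqr_ge0.
have -> : \sum_i (t * x i 0 - s * y i 0) ^+ 2 =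
    t ^+ 2 * (\sum_i x i 0 ^+ 2) + s ^+ 2 * (\sum_i y i 0 ^+ 2)
      - 2 * (s * t) * \sum_i x i 0 * y i 0.
  rewrite !mulr_sumr -big_split/= -sumrB; apply: eq_bigr => i _; ring.
rewrite -!sqr_norm2 -/s -/t => h; rewrite -(ler_pM2l st_gt0); nra.
Qed.

Lemma norm2D n (x y : 'cV[R]_n) : norm2 (x + y) <= norm2 x + norm2 y.
Proof.
rewrite -(@ler_pXn2r _ 2) ?nnegrE ?addr_ge0 ?norm2_ge0//.
rewrite sqrrD !sqr_norm2.
have -> : \sum_i (x + y) i 0 ^+ 2 =
    \sum_i x i 0 ^+ 2 + (\sum_i x i 0 * y i 0) *+ 2 + \sum_i y i 0 ^+ 2.
  by rewrite -sumrMnl -!big_split/=; apply: eq_bigr => i _; rewrite mxE sqrrD.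
by rewrite lerD2r lerD2l lerMn2r norm2_cauchy_schwarz.
Qed.

Lemma norm2_le_sum n (x : 'cV[R]_n) (e : R) :
  (forall i, `|x i 0| <= e) -> norm2 x <= n%:R * e.
Proof.
(* Without coordinates nothing forces [e] to be nonnegative, but both sides are 0. *)
case: n x => [|n] x xe.
  by rewrite /norm2 big_ord0 sqrtr0 mul0r.
have e0 : 0 <= e by exact: le_trans (xe 0).
rewrite -(@ler_pXn2r _ 2) ?nnegrE ?norm2_ge0 ?mulr_ge0// sqr_norm2.
apply: (@le_trans _ _ (\sum_(i < n.+1) e ^+ 2)).
  apply: ler_sum => i _; rewrite -[leLHS]real_normK ?num_real//.
  by rewrite ler_pXn2r// nnegrE.
rewrite sumr_const card_ord exprMn -[leLHS]mulr_natl ler_wpM2r ?sqr_ge0//.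
by rewrite -natrX ler_nat leq_pmull.
Qed.

Lemma norm2_orthomxT m n (V : 'M[R]_(m, n)) y :
  orthomx V -> norm2 (V^T *m y) = norm2 y.
Proof.
move=> VV; apply/eqP; rewrite -(@eqrXn2 _ 2) ?norm2_ge0//.
by rewrite !sqr_norm2_mx trmx_mul trmxK -mulmxA (mulmxA V) VV mul1mx.
Qed.

(** [V^T *m V] is an orthogonal projection; by Pythagoras the loss in squared norm is the squared
    norm of [x - V^T *m (V *m x)]. *)
Lemma norm2_orthomx m n (V : 'M[R]_(m, n)) x :
  orthomx V -> norm2 (V *m x) <= norm2 x.
Proof.
move=> VV; rewrite -(@ler_pXn2r _ 2) ?nnegrE ?norm2_ge0// -subr_ge0.
suff -> : norm2 x ^+ 2 - norm2 (V *m x) ^+ 2 = norm2 (x - V^T *m (V *m x)) ^+ 2.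
  exact: sqr_ge0.
set y := V *m x; set z := V^T *m y.
have xz : x^T *m z = y^T *m y by rewrite /z mulmxA -trmx_mul.
have zx : z^T *m x = y^T *m y by rewrite /z trmx_mul trmxK -mulmxA.
have zz : z^T *m z = y^T *m y.
  by rewrite /z trmx_mul trmxK -mulmxA (mulmxA V) VV mul1mx.
rewrite !sqr_norm2_mx [(x - z)^T]linearB/= mulmxBl !mulmxBr xz zx zz.
by rewrite subrr subr0 !mxE.
Qed.

End euclidean_norm.

(** * Measurability of vector operations, and partitions of small mesh *)

Section measurability.
Context {R : realType}.
Local Open Scope ring_scope.

Lemma measurable_norm2 n :
  measurable_fun setT (@norm2 R n : Rn R n -> measurableTypeR R).
Proof.
rewrite /norm2; apply: (measurableT_comp (continuous_measurable_fun (@sqrt_continuous R))).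
by apply: measurable_sum => i; apply: measurable_funX; exact: measurable_coord.
Qed.

Lemma measurable_funD_Rn d (T : measurableType d) n (f g : T -> Rn R n) :
  measurable_fun setT f -> measurable_fun setT g ->
  measurable_fun setT (fun t => f t + g t : Rn R n).
Proof.
move=> mf mg; apply: measurable_fun_RnP => i; under eq_fun do rewrite mxE.
by apply: measurable_funD; apply: (measurableT_comp (measurable_coord i)).
Qed.

Lemma measurable_mulmx m n (V : 'M[R]_(m, n)) :
  measurable_fun setT ((fun x : 'cV[R]_n => V *m x) : Rn R n -> Rn R m).
Proof.
apply: measurable_fun_RnP => i; under eq_fun do rewrite mxE.
by apply: measurable_sum => j; apply: measurable_funM => //; exact: measurable_coord.
Qed.

Lemma measurable_oppRn n :
  measurable_fun setT ((fun x : 'cV[R]_n => - x) : Rn R n -> Rn R n).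
Proof.
apply: measurable_fun_RnP => i; under eq_fun do rewrite mxE.
by apply: measurable_funN; exact: measurable_coord.
Qed.

Lemma measurable_affine_Rn m n (V : 'M[R]_(m, n)) b :
  measurable_fun setT (affine_Rn V b : Rn R n -> Rn R m).
Proof.
by apply: measurable_funD_Rn => //; exact: measurable_mulmx.
Qed.

Lemma measurable_funB_Rn d (T : measurableType d) n (f g : T -> Rn R n) :
  measurable_fun setT f -> measurable_fun setT g ->
  measurable_fun setT (fun t => (f t : 'cV[R]_n) - g t : Rn R n).
Proof.
move=> mf mg; apply: measurable_funD_Rn => //.
exact: (measurableT_comp (@measurable_oppRn n)).
Qed.

Lemma measurable_dist2 n :
  measurable_fun setT (@dist2 R n : Rn R n * Rn R n -> measurableTypeR R).
Proof.
apply: (measurableT_comp (@measurable_norm2 n)).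
by apply: measurable_funB_Rn; [exact: measurable_fst|exact: measurable_snd].
Qed.

(** The cells are the half-open cubes of a grid of side [h], numbered by encoding the integer
    vectors of their corners. *)
Lemma countable_cells m (e : R) : 0 < e ->
  exists2 k : Rn R m -> nat, measurable_fun setT k &
    forall x y, k x = k y -> norm2 ((x : 'cV[R]_m) - y) <= e.
Proof.
move=> e0.
(* Points of a cube of side [h] are at distance at most [m%:R * h]; dividing by [m.+1] keeps this
   below [e] and covers [m = 0]. *)
pose h := e / m.+1%:R.
have h0 : 0 < h by rewrite divr_gt0.
pose q (x : Rn R m) : 'cV[int]_m := \col_i Num.floor ((x : 'cV[R]_m) i 0 / h).
exists (fun x => pickle (q x)).
  move=> _ Y _; rewrite setTI.
  rewrite (_ : _ @^-1` Y = \bigcup_(z in [set z : 'cV[int]_m | Y (pickle z)])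
      (q @^-1` [set z])); last first.
    apply/seteqP; split => [x Yx|x [z Yz qz]]; first by exists (q x).
    by move: Yz; rewrite -qz.
  rewrite bigcup_mkcond; apply: countable_bigcupT_measurable => // z.
  case: ifPn => // _.
  rewrite (_ : q @^-1` _ = \big[setI/setT]_(i : 'I_m)
      ((fun x : 'cV[R]_m => x i 0) @^-1`
        `[(z i 0)%:~R * h, (z i 0 + 1)%:~R * h[)).
    apply: bigsetI_measurable => i _; apply: measurable_preimageT => //.
    exact: measurable_coord.
  have qE (x : 'cV[R]_m) i : (Num.floor (x i 0 / h) == z i 0) =
      (x i 0 \in `[(z i 0)%:~R * h, (z i 0 + 1)%:~R * h[).
    by rewrite floor_eq in_itv/= ler_pdivlMr// ltr_pdivrMr// -rmorphD.
  rewrite -bigcap_seq; apply/seteqP; split => x /=.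
    by move=> xz i _ /=; rewrite -qE -xz mxE.
  move=> + ; move=> xz; apply/matrixP => i j; rewrite ord1 mxE; apply/eqP.
  by rewrite qE; apply: xz; rewrite /= mem_index_enum.
move=> x y /(pcan_inj (@pickleK _)) qxy.
apply: (@le_trans _ _ (m%:R * h)).
  apply: norm2_le_sum => i; rewrite !mxE.
  have : q x i 0 = q y i 0 by rewrite qxy.
  rewrite !mxE => fxy.
  have /andP[x1 x2] := floor_itv ((x : 'cV[R]_m) i 0 / h).
  have /andP[y1 y2] := floor_itv ((y : 'cV[R]_m) i 0 / h).
  rewrite -[leRHS]mul1r -ler_pdivrMr// -[in X in _ / X](gtr0_norm h0) -normf_div.
  rewrite fxy in x1 x2; rewrite mulrBl ler_norml.
  move: x1 x2 y1 y2; rewrite !rmorphD/= => *; apply/andP; split; lra.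
rewrite /h mulrCA ler_piMr ?(ltW e0)// ler_pdivrMr// mul1r ler_nat; lia.
Qed.

End measurability.

(** * Lp norms and Wasserstein distances *)

Section Lnorm_complements.
Context {R : realType}.

Lemma le_poweR (x y : \bar R) (r : R) : (0 <= r)%R -> 0 <= x -> x <= y ->
  x `^ r <= y `^ r.
Proof.
move=> r0 x0 xy; apply: gt0_ler_poweR => //.
  by rewrite in_itv/= x0 leey.
by rewrite in_itv/= (le_trans x0 xy) leey.
Qed.

(** On nonnegative extended reals the power [s] is an increasing bijection, with inverse the power
    [s^-1], so it commutes with infima. *)
Lemma poweR_ereal_inf (S : set (\bar R)) (s : R) : (0 < s)%R ->
  (forall x, S x -> 0 <= x) ->
  (ereal_inf S) `^ s = ereal_inf [set x `^ s | x in S].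
Proof.
move=> s0 S0.
have infS0 : 0 <= ereal_inf S by exact: le_ereal_inf_tmp.
apply/eqP; rewrite eq_le; apply/andP; split.
  apply: le_ereal_inf_tmp => _ [x Sx <-]; apply: le_poweR => //; first exact: ltW.
  exact: ereal_inf_lbound.
set z := ereal_inf [set _ | _ in _].
have z0 : 0 <= z by apply: le_ereal_inf_tmp => _ [x Sx <-]; exact: poweR_ge0.
have -> : z = (z `^ s^-1) `^ s by rewrite -poweRrM mulVf ?gt_eqF// poweRe1.
apply: le_poweR; [exact: ltW|exact: poweR_ge0|].
apply: le_ereal_inf_tmp => x Sx.
have -> : x = (x `^ s) `^ s^-1 by rewrite -poweRrM mulfV ?gt_eqF// poweRe1// S0.
apply: le_poweR => //; first by rewrite invr_ge0 ltW.
by apply: ereal_inf_lbound; exists x.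
Qed.

Lemma Lnorm_EFin d (T : measurableType d) (mu : {measure set T -> \bar R})
    (r : R) (f : T -> R) :
  'N[mu]_(r%:E)[EFin \o f] = (\int[mu]_x (`|f x| `^ r)%:E) `^ r^-1.
Proof. by rewrite unlock. Qed.

Lemma measurable_normr_powR d (T : measurableType d) (f : T -> R) (r : R) :
  measurable_fun setT f -> measurable_fun setT (fun x => (`|f x| `^ r)%:E).
Proof.
move=> mf; apply/measurable_EFinP; apply: (measurableT_comp (measurable_powR _)).
exact: measurableT_comp.
Qed.

Lemma le_Lnorm d (T : measurableType d) (mu : {measure set T -> \bar R}) p
    (f g : T -> R) :
  measurable_fun setT f -> measurable_fun setT g -> 1 <= p ->
  (\forall x \ae mu, (`|f x| <= `|g x|)%R) ->
  'N[mu]_p[EFin \o f] <= 'N[mu]_p[EFin \o g].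
Proof.
move=> mf mg; case: p => [r|_ fg|//].
  rewrite lee_fin => r1 fg; have r0 : (0 < r)%R by exact: lt_le_trans r1.
  rewrite !Lnorm_EFin; apply: le_poweR; [by rewrite invr_ge0 ltW| |].
    by apply: integral_ge0 => x _; rewrite lee_fin powR_ge0.
  have ge0 (h : T -> R) x : [set: T] x -> 0 <= (`|h x| `^ r)%:E.
    by rewrite lee_fin powR_ge0.
  apply: (ae_ge0_le_integral measurableT (ge0 f) _ (ge0 g));
    [exact: measurable_normr_powR..|].
  apply: filterS fg => x fg _; rewrite lee_fin.
  by apply: ge0_ler_powR; rewrite ?nnegrE// ltW.
rewrite unlock; case: ifPn => // _; apply: le_ess_sup.
by apply: filterS fg => x; rewrite /= lee_fin.
Qed.

Lemma Lnorm_probability_cst d (T : measurableType d) (P : probability T R) p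
    (c : R) : 1 <= p -> (0 <= c)%R -> 'N[P]_p[EFin \o cst c] = c%:E.
Proof.
move=> + c0; case: p => [r|_|//].
  rewrite lee_fin Lnorm_EFin => r1; have r0 : (0 < r)%R by exact: lt_le_trans r1.
  rewrite [X in X `^ _](_ : _ = \int[P]_x (cst (`|c| `^ r)%:E) x)//.
  rewrite integral_cst// [X in _ * X](_ : _ = 1); last exact: probability_setT.
  rewrite mule1 ger0_norm// -poweR_EFin -poweRrM.
  by rewrite mulfV ?gt_eqF// poweRe1.
rewrite unlock /= probability_setT lte01 (_ : abse \o _ = cst c%:E).
  rewrite ess_sup_cst// [X in _ < X](_ : _ = 1) ?lte01//; exact: probability_setT.
by apply/funext => x /=; rewrite ger0_norm.
Qed.

Lemma Lnorm_pushforward d1 d2 (T1 : measurableType d1) (T2 : measurableType d2)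
    (P : probability T1 R) (Q : probability T2 R) (phi : T1 -> T2) p (f : T2 -> R) :
  measurable_fun setT phi -> measurable_fun setT f -> 1 <= p ->
  eq_measure (pushforward P phi) Q ->
  'N[Q]_p[EFin \o f] = 'N[P]_p[EFin \o f \o phi].
Proof.
move=> mphi mf + PQ; case: p => [r _|_|//].
  rewrite [RHS](Lnorm_EFin _ _ (f \o phi)) Lnorm_EFin; congr (_ `^ _).
  rewrite (@eq_measure_integral _ _ _ setT (pushforward P phi) Q).
    rewrite ge0_integral_pushforward//; exact: measurable_normr_powR.
  by move=> A mA _; exact/esym/PQ.
(* For [p = +oo] the essential upper bounds coincide: [y] is one iff the set where it is exceeded is
   null, a condition that the pushforward preserves. *)
rewrite unlock /= !probability_setT lte01 /ess_sup; congr ereal_inf; apply/seteqP.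
have mabs : measurable_fun setT (abse \o (EFin \o f)).
  by apply: measurableT_comp => //; exact/measurable_EFinP.
have mabs' : measurable_fun setT (abse \o (EFin \o f \o phi)).
  by apply: measurableT_comp => //; apply/measurable_EFinP; exact: measurableT_comp.
have mI y : measurable ((abse \o (EFin \o f)) @^-1` `]y, +oo[).
  by apply: measurable_preimageT => //; exact: emeasurable_itv.
split => y /= /ae_le_measureP h.
  by apply/(@ae_le_measureP _ _ _ P) => //; rewrite -(h mabs); exact: PQ.
apply/(@ae_le_measureP _ _ _ Q) => //; rewrite -(h mabs'); exact/esym/PQ.
Qed.

(** Together with [wassersteinE], this expresses finite [p] and [p = +oo] alike by [Lnorm], so that
    the transport arguments treat both at once. *)
Lemma finite_momentE n p (mu : probability (Rn R n) R) : 1 <= p ->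
  finite_moment p mu <-> 'N[mu]_p[EFin \o (@norm2 R n : Rn R n -> R)] < +oo.
Proof.
case: p => [r|_|//]; last first.
  rewrite unlock /= probability_setT lte01.
  rewrite (_ : abse \o _ = (fun x => (norm2 x)%:E))//.
  by apply/funext => x /=; rewrite ger0_norm// norm2_ge0.
rewrite Lnorm_EFin /finite_moment /= lee_fin => r1; have r0 : (0 < r)%R by exact: lt_le_trans r1.
under [in X in _ <-> X]eq_integral do rewrite ger0_norm ?norm2_ge0//.
split; first exact: poweR_lty.
by apply: lty_poweRy; rewrite invr_neq0// gt_eqF.
Qed.

Lemma wassersteinE n p (mu nu : probability (Rn R n) R) : 1 <= p ->
  wasserstein p mu nu =
  ereal_inf [set 'N[gamma]_p[EFin \o (@dist2 R n)] | gamma in couplings mu nu].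
Proof.
case: p => [r|_|//].
  rewrite lee_fin /wasserstein => r1; have r0 : (0 < r)%R by exact: lt_le_trans r1.
  rewrite poweR_ereal_inf ?invr_gt0//; last first.
    by move=> _ [g _ <-]; apply: integral_ge0 => z _; rewrite lee_fin powR_ge0.
  rewrite [in LHS]image_comp; congr ereal_inf.
  apply: eq_imagel => g _; rewrite Lnorm_EFin /=; congr (_ `^ _).
  by apply: eq_integral => z _; rewrite ger0_norm// norm2_ge0.
rewrite /wasserstein; congr ereal_inf; apply: eq_imagel => g _.
rewrite unlock /= probability_setT lte01; congr ess_sup; apply/funext => z /=.
by rewrite ger0_norm// norm2_ge0.
Qed.

End Lnorm_complements.

(** * Transport of couplings along affine projections *)

Section wasserstein_embedding.
Context {R : realType}.

Lemma wasserstein_affine_Rn m n (p : \bar R) (V : 'M[R]_(m, n)) b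
    (alpha nu : probability (Rn R n) R) (mu beta : probability (Rn R m) R) :
  1 <= p -> orthomx V ->
  eq_measure (pushforward alpha (affine_Rn V b)) mu ->
  eq_measure (pushforward nu (affine_Rn V b)) beta ->
  wasserstein p mu beta <= wasserstein p alpha nu.
Proof.
move=> p1 VV amu nbeta; rewrite !wassersteinE//.
set phi := affine_Rn V b in amu nbeta *.
have mphi : measurable_fun setT phi by exact: measurable_affine_Rn.
apply: le_ereal_inf_tmp => _ [g [g1 g2] <-].
pose psi z := (phi z.1, phi z.2).
have mpsi : measurable_fun setT psi.
  by apply/measurable_fun_pairP; split; apply: (measurableT_comp mphi);
    [exact: measurable_fst|exact: measurable_snd].
have [h hE] := pushforward_probability g mpsi.
apply: ge_ereal_inf; exists ('N[h]_p[EFin \o (@dist2 R m)]).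
  exists h => //; split => A mA; rewrite /pushforward hE /pushforward.
    exact: etrans (g1 _ (measurable_preimageT mphi mA)) (amu _ mA).
  exact: etrans (g2 _ (measurable_preimageT mphi mA)) (nbeta _ mA).
have mdistm := @measurable_dist2 R m.
have mdistn := @measurable_dist2 R n.
have gh : eq_measure (pushforward g psi) h by rewrite hE.
rewrite (Lnorm_pushforward mpsi _ _ gh)//.
apply: le_Lnorm => //; first exact: (measurableT_comp mdistm mpsi).
(* The shift [b] cancels in the difference, and [V] does not increase norms. *)
apply/nearW => z /=; rewrite !ger0_norm ?norm2_ge0// /dist2/= /phi /affine_Rn.
by rewrite opprD addrACA subrr addr0 -mulmxBr norm2_orthomx.
Qed.

Lemma coupling_embedding m n (p : \bar R) (V : 'M[R]_(m, n)) b
    (nu : probability (Rn R n) R) (mu beta : probability (Rn R m) R) gamma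
    (e : R) :
  1 <= p -> orthomx V -> finite_moment p mu -> finite_moment p nu ->
  eq_measure (pushforward nu (affine_Rn V b)) beta ->
  couplings mu beta gamma -> (0 < e)%R ->
  exists2 alpha, embeddings_moment p mu n alpha &
    wasserstein p alpha nu <= 'N[gamma]_p[EFin \o (@dist2 R m)] + e%:E.
Proof.
move=> p1 VV fmu fnu nbeta [gmu gbeta] e0.
set phi := affine_Rn V b in nbeta *.
have mphi : measurable_fun setT phi by exact: measurable_affine_Rn.
have [k mk ke] := @countable_cells R m e e0.
have msnd : measurable_fun setT (snd : Rn R m * Rn R m -> Rn R m).
  exact: measurable_snd.
(* [T] couples [gamma] with [nu] so that the second point of [gamma] and the image under [phi] lie
   in the same cell; the cell masses match, both being those under [beta]. *)
have [|T [T1 T2 T0]] := @glue_countable _ _ _ _ R gamma nu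
    (k \o snd) (k \o phi) (measurableT_comp mk msnd) (measurableT_comp mk mphi).
  move=> i; have mi : measurable (k @^-1` [set i]) by exact: measurable_preimageT.
  by transitivity (beta (k @^-1` [set i])); [exact: gbeta|exact/esym/nbeta].
(* [X w] moves the fibre of [phi] through [w.2] orthogonally to the fibre over
   the first coordinate of [w.1]. *)
pose X (w : (Rn R m * Rn R m) * Rn R n) : Rn R n :=
  ((w.2 : 'cV[R]_n) + V^T *m ((w.1.1 : 'cV[R]_m) - phi w.2))%R.
have phiX w : phi (X w) = w.1.1.
  rewrite /X /phi /affine_Rn mulmxDr mulmxA VV mul1mx.
  by apply/matrixP => i j; rewrite !mxE; ring.
have m11 : measurable_fun setT (fun w : (Rn R m * Rn R m) * Rn R n => w.1.1).
  exact: (measurableT_comp measurable_fst measurable_fst).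
have m2 : measurable_fun setT (fun w : (Rn R m * Rn R m) * Rn R n => w.2).
  exact: measurable_snd.
have mphi2 := measurableT_comp mphi m2.
have mX : measurable_fun setT X.
  apply: measurable_funD_Rn => //; apply: (measurableT_comp (measurable_mulmx _)).
  exact: measurable_funB_Rn.
have mXY : measurable_fun setT (fun w => (X w, w.2)).
  exact/measurable_fun_pairP.
have [alpha alphaE] := pushforward_probability T mX.
have [g gE] := pushforward_probability T mXY.
have mnormm := @measurable_norm2 R m.
have mnormn := @measurable_norm2 R n.
have mdistm := @measurable_dist2 R m.
have mdistn := @measurable_dist2 R n.
have T11 : eq_measure (pushforward T (fun w => w.1.1)) mu.
  move=> A mA; rewrite -gmu//; apply: T1; exact: measurable_preimageT.
(* All terms of this bound have a finite [p]-norm, so Minkowski gives [alpha] a finite moment; [w.2]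
   counts twice, by itself and through [phi w.2]. *)
have X_le w : (norm2 (X w) <=
    (norm2 (w.2 : 'cV[R]_n) *+ 2 + (norm2 (w.1.1 : 'cV[R]_m) + norm2 b)))%R.
  rewrite (le_trans (norm2D _ _))// mulr2n -addrA lerD2l norm2_orthomxT//.
  rewrite (le_trans (norm2D _ _))// norm2N addrCA lerD2l.
  by rewrite (le_trans (norm2D _ _))// lerD2r norm2_orthomx.
exists alpha; first split.
- apply/(finite_momentE _ p1).
  have Talpha : eq_measure (pushforward T X) alpha by rewrite alphaE.
  rewrite (Lnorm_pushforward mX _ _ Talpha)//.
  pose F0 (w : (Rn R m * Rn R m) * Rn R n) := norm2 (w.2 : 'cV[R]_n).
  pose F1 (w : (Rn R m * Rn R m) * Rn R n) := norm2 (w.1.1 : 'cV[R]_m).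
  have mF0 : measurable_fun setT F0 by exact: (measurableT_comp mnormn).
  have mF1 : measurable_fun setT F1 by exact: (measurableT_comp mnormm).
  apply: (@le_lt_trans _ _
    ('N[T]_p[EFin \o ((F0 \+ F0) \+ (F1 \+ cst (norm2 b)))%R])).
    apply: le_Lnorm => //.
    + exact: (measurableT_comp mnormn mX).
    + by do !apply: measurable_funD => //.
    apply/nearW => w /=; rewrite !ger0_norm ?norm2_ge0 ?addr_ge0 ?norm2_ge0//.
  have lt_inftyD (x y : \bar R) : x < +oo -> y < +oo -> x + y < +oo.
    by exact: lte_add_pinfty.
  have NF0 : 'N[T]_p[EFin \o F0] < +oo.
    move/(finite_momentE _ p1) : fnu; rewrite (Lnorm_pushforward m2 _ _ T2)//.
  have NF1 : 'N[T]_p[EFin \o F1] < +oo.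
    move/(finite_momentE _ p1) : fmu.
    by rewrite (Lnorm_pushforward m11 _ _ T11).
  have Nb : 'N[T]_p[EFin \o cst (norm2 b)] < +oo.
    by rewrite Lnorm_probability_cst ?norm2_ge0 ?ltry.
  rewrite (le_lt_trans (eminkowski _ _ _ _))//; try by apply: measurable_funD.
  rewrite lt_inftyD// (le_lt_trans (eminkowski _ _ _ _))//; exact: lt_inftyD.
- exists V, b; split => // A mA; rewrite /pushforward alphaE /pushforward -T11//.
  by congr (T _); apply/seteqP; split => w; rewrite /preimage /= -/phi phiX.
rewrite wassersteinE//; apply: ge_ereal_inf.
exists ('N[g]_p[EFin \o (@dist2 R n)]).
  exists g => //; split => A mA; rewrite /pushforward gE /pushforward.
    by rewrite alphaE.
  exact: T2.
have Tg : eq_measure (pushforward T (fun w => (X w, w.2))) g by rewrite gE.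
rewrite (Lnorm_pushforward mXY _ _ Tg)//.
pose G (w : (Rn R m * Rn R m) * Rn R n) := dist2 w.1.
have mG : measurable_fun setT G by exact: (measurableT_comp mdistm).
apply: (@le_trans _ _ 'N[T]_p[EFin \o (G \+ cst e)%R]).
  apply: le_Lnorm => //; [exact: (measurableT_comp mdistn mXY)|exact: measurable_funD|].
  (* [X w] is at distance [norm2 (w.1.1 - phi w.2)] from [w.2]; the detour through [w.1.2] costs at
     most [e], as [w.1.2] and [phi w.2] share a cell. *)
  apply: (@filterS _ _ (ae_filter_ringOfSetsType T)) T0 => w /= kw.
  rewrite !ger0_norm ?addr_ge0 ?norm2_ge0 ?(ltW e0)//.
  rewrite /dist2/= /X addrAC subrr add0r norm2_orthomxT//.
  rewrite (_ : _ - _ = ((w.1.1 : 'cV[R]_m) - w.1.2) +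
                       ((w.1.2 : 'cV[R]_m) - phi w.2))%R.
    by rewrite (le_trans (norm2D _ _))// lerD2l ke.
  by rewrite addrA subrK.
rewrite (le_trans (eminkowski _ _ _ _))// leeD//.
  by rewrite (Lnorm_pushforward measurable_fst _ _ T1).
by rewrite Lnorm_probability_cst// ltW.
Qed.

End wasserstein_embedding.

(** * Lebesgue measure *)

Section lebesgue_translation.
Context {R : realType}.

(** Lebesgue measure is determined by its values on half-open intervals, whose lengths a shift
    preserves. *)
Lemma lebesgue_measure_translation (a : R) (A : set (measurableTypeR R)) :
  measurable A ->
  lebesgue_measure ((fun x : R => (x + a)%R) @^-1` A) = lebesgue_measure A.
Proof.
have mD : measurable_fun setT ((fun x => (x + a)%R) : measurableTypeR R -> measurableTypeR R).
  exact: measurable_funD.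
pose m : {measure set (measurableTypeR R) -> \bar R} :=
  pushforward lebesgue_measure
    ((fun x => (x + a)%R) : measurableTypeR R -> measurableTypeR R).
move=> mA; rewrite [RHS](@lebesgue_measure_unique _ (m mD))// => _ [[x y]] _ <-.
rewrite /m/= /pushforward (_ : _ @^-1` _ = `]x - a, y - a]%classic)%R; last first.
  by apply/seteqP; split => z /=; rewrite !in_itv/= ltrBlDr lerBrDr.
by rewrite !lebesgue_measure_itv/= !lte_fin ltrD2r -!EFinB opprB addrA subrK.
Qed.

Lemma cons_RnD n (z : measurableTypeR R * Rn R n) (v : 'cV[R]_n.+1) :
  ((cons_Rn z : 'cV[R]_n.+1) + v)%R =
  cons_Rn ((z.1 + v 0 0)%R,
    ((z.2 : 'cV[R]_n) + dsubmx (v : 'cV[R]_(1 + n)))%R).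
Proof.
rewrite /cons_Rn/= -[in LHS](@vsubmxK R 1 n 1 v) (@add_col_mx R 1 n 1).
congr (@col_mx R 1 n 1 _ _); apply/matrixP => i j; rewrite !mxE !ord1 eqxx.
by rewrite !mulr1n; congr (_ + v _ _)%R; exact/val_inj.
Qed.

(** Induction on the dimension: the shift acts separately on the first coordinate and on the others,
    and a product measure is determined by its values on rectangles. *)
Lemma lebesgue_Rn_translation n (v : 'cV[R]_n) (A : set (Rn R n)) :
  measurable A ->
  lebesgue_Rn n ((fun x : 'cV[R]_n => (x + v)%R) @^-1` A) = lebesgue_Rn n A.
Proof.
elim: n v A => [|n IH] v A mA.
  congr (lebesgue_Rn 0 _); apply/seteqP.
  by split => x /=; rewrite (_ : (x + v)%R = x)//; apply/matrixP => -[].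
have mT k (w : 'cV[R]_k) :
    measurable_fun setT ((fun x : 'cV[R]_k => (x + w)%R) : Rn R k -> Rn R k).
  exact: measurable_funD_Rn.
rewrite /= /pushforward.
set a := v 0%R 0%R; set w := dsubmx (v : 'cV[R]_(1 + n)).
pose tau (z : measurableTypeR R * Rn R n) : measurableTypeR R * Rn R n :=
  ((z.1 + a)%R, ((z.2 : 'cV[R]_n) + w)%R).
have mtau : measurable_fun setT tau.
  apply/measurable_fun_pairP; split; first by apply: measurable_funD.
  by apply: (measurableT_comp (mT _ w)); exact: measurable_snd.
pose mu : {measure set (measurableTypeR R * Rn R n)%type -> \bar R} :=
  pushforward (lebesgue_measure \x lebesgue_Rn n) tau.
have mB : measurable (@cons_Rn R n @^-1` A).
  by apply: measurable_preimageT => //; exact: measurable_cons_Rn.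
rewrite [RHS](@product_measure_unique _ _ _ _ _ _ _ (mu mtau))//.
  rewrite /mu/= /pushforward; congr (product_measure1 _ _ _).
  by apply/seteqP; split => z /=; rewrite cons_RnD.
move=> B C mB' mC; rewrite /mu/= /pushforward.
rewrite (_ : _ @^-1` _ = ((fun x : R => (x + a)%R) @^-1` B) `*`
    ((fun x : 'cV[R]_n => (x + w)%R) @^-1` C))//.
rewrite product_measure1E.
- by rewrite -[X in _ = X * _](lebesgue_measure_translation a)// -(IH w).
- by apply: (@measurable_preimageT _ _ (measurableTypeR R) (measurableTypeR R)) => //;
    apply: measurable_funD.
- by apply: (@measurable_preimageT _ _ (Rn R n) (Rn R n)).
Qed.

(* Translating by [V^T y] moves the fibre over [z] to the fibre over [z + y],
   so all translates of [A] have null preimage, and Tonelli applies. *)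
Lemma lebesgue_Rn_affine_null m n (V : 'M[R]_(m, n)) b (A : set (Rn R m)) :
  orthomx V -> measurable A ->
  lebesgue_Rn n (affine_Rn V b @^-1` A) = 0 -> lebesgue_Rn m A = 0.
Proof.
move=> VV mA A0; set phi := affine_Rn V b.
have mphi : measurable_fun setT phi by exact: measurable_affine_Rn.
pose s (z : Rn R n * Rn R m) : Rn R m := ((phi z.1 : 'cV[R]_m) + z.2)%R.
have ms : measurable_fun setT s.
  apply: measurable_funD_Rn; last exact: measurable_snd.
  exact: (measurableT_comp mphi measurable_fst).
pose f (z : Rn R n * Rn R m) := (\1_A (s z))%:E : \bar R.
have mf : measurable_fun setT f.
  by apply/measurable_EFinP; apply: (measurableT_comp _ ms); exact: measurable_indic.
have f0 z : 0 <= f z by rewrite lee_fin.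
have intf d (T : measurableType d) (mu : {measure set T -> \bar R}) (t : T -> Rn R m) :
    measurable_fun setT t -> \int[mu]_x (\1_A (t x))%:E = mu (t @^-1` A).
  by move=> mt; rewrite -(setIT (t @^-1` A)) -integral_indic//; exact: measurable_preimageT.
(* Integrating over [x] first gives 0, every section being a translate of the null preimage;
   integrating over [y] first gives the measure of [A] times that of the whole space. *)
have := fubini_tonelli (m1 := lebesgue_Rn n) (m2 := lebesgue_Rn m) f mf f0.
have -> : (fun y => \int[lebesgue_Rn n]_x f (x, y)) = cst 0.
  apply/funext => y; rewrite /f intf; last first.
    exact: (measurableT_comp ms (measurable_pair2 _)).
  rewrite (_ : _ @^-1` _ =
      (fun x : 'cV[R]_n => (x + V^T *m y)%R) @^-1` (phi @^-1` A)).
    exact: etrans (lebesgue_Rn_translation _ (measurable_preimageT mphi mA)) A0.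
  have sE (x : 'cV[R]_n) : s (x, y) = phi (x + V^T *m y)%R.
    by rewrite /s/phi/affine_Rn/= mulmxDr mulmxA VV mul1mx addrAC.
  by apply/seteqP; split => x; rewrite /preimage /= sE.
have -> : (fun x => \int[lebesgue_Rn m]_y f (x, y)) = cst (lebesgue_Rn m A).
  apply/funext => x; rewrite /f intf; last first.
    exact: (measurableT_comp ms (measurable_pair1 _)).
  rewrite -[RHS](lebesgue_Rn_translation (phi x) mA); congr (lebesgue_Rn m _).
  by apply/seteqP; split => y; rewrite /preimage /s /= addrC.
rewrite integral0 integral_cst// => /eqP; rewrite mule_eq0 => /orP[/eqP//|].
(* The mass of the whole space cannot vanish: it is at least that of the unit cube, which is 1. *)
rewrite -measure_le0 => lT0; exfalso.
have := @lebesgue_Rn_box R n 0%R (const_mx 1%R).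
under [in X in (_ -> _ = X) -> _]eq_bigr do rewrite !mxE subr0.
rewrite big1// => /(_ _)/wrap[]; first by move=> i; rewrite !mxE.
move=> box; suff : (1 : \bar R) <= 0 by rewrite lee_fin ler10.
rewrite -box (le_trans _ lT0)// le_measure ?inE//; exact: measurable_Rn_box.
Qed.

End lebesgue_translation.

(** * Convex functions *)

Section convex.
Context {R : realType}.
Local Open Scope ring_scope.

Lemma convex_function_three_points (f : R -> R) (s t u : R) :
  convex_function [set: R^o] f -> t < s -> s < u ->
  (u - t) * f s <= (u - s) * f t + (s - t) * f u.
Proof.
move=> cf ts su; have tu : 0 < u - t by rewrite subr_gt0 (lt_trans ts).
have l0 : 0 <= (u - s) / (u - t) by rewrite divr_ge0 ?(ltW tu)// subr_ge0 ltW.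
have l1 : (u - s) / (u - t) <= 1.
  by rewrite ler_pdivrMr// mul1r lerD2l lerN2 ltW.
pose l := (u - s) / (u - t).
have : f (l * t + (1 - l) * u) <= l * f t + (1 - l) * f u.
  exact: cf (Itv01 l0 l1) t u (in_setT _) (in_setT _).
have -> : l * t + (1 - l) * u = s by rewrite /l; field; rewrite gt_eqF.
rewrite -(ler_pM2l tu) => /le_trans; apply.
by rewrite le_eqVlt; apply/orP; left; apply/eqP; rewrite /l; field; rewrite gt_eqF.
Qed.

(** The subgradient at [s] is the right derivative, taken as the infimum of the slopes of the chords
    going right from [s]. *)
Lemma convex_function_subgradient (f : R -> R) :
  convex_function [set: R^o] f ->
  exists2 c : R -> R, {homo c : x y / x <= y} &
    forall s t, f s + c s * (t - s) <= f t.
Proof.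
move=> cf.
pose S s := [set (f u - f s) / (u - s) | u in [set u | s < u]].
(* Chords arriving at [s] from the left are less steep; this makes the infimum finite and yields the
   subgradient inequality to the left of [s]. *)
have lbS s t : t < s -> lbound (S s) ((f s - f t) / (s - t)).
  move=> ts _ [u su <-]; rewrite ler_pdivlMr ?subr_gt0// mulrAC.
  rewrite ler_pdivrMr ?subr_gt0//.
  have := convex_function_three_points cf ts su; nra.
have S0 s : S s !=set0 by exists ((f (s + 1) - f s) / (s + 1 - s)), (s + 1) => //=; rewrite ltrDl.
have hlS s : has_lbound (S s).
  by exists ((f s - f (s - 1)) / (s - (s - 1))); apply: lbS; rewrite gtrBl.
have sub s t : f s + inf (S s) * (t - s) <= f t.
  have [ts|st|->] := ltgtP t s.
  - have := lb_le_inf (S0 s) (lbS s t ts).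
    rewrite ler_pdivrMr ?subr_gt0//; nra.
  - have : inf (S s) <= (f t - f s) / (t - s) by apply: ge_inf => //; exists t.
    rewrite ler_pdivlMr ?subr_gt0//; nra.
  - by rewrite subrr mulr0 addr0.
(* Monotonicity comes from adding the subgradient inequalities at [x] and at [y]. *)
exists (fun s => inf (S s)) => // x y; rewrite le_eqVlt => /predU1P[->//|xy].
have := sub x y; have := sub y x; have : 0 < y - x by rewrite subr_gt0.
nra.
Qed.

(** Sublevel sets are intervals: for [z] between [x] and [y], the sign of [c z] tells at which of
    the two [f] is at least [f z]. *)
Lemma subgradient_measurable (f c : R -> R) :
  (forall s t, f s + c s * (t - s) <= f t) -> measurable_fun setT f.
Proof.
move=> sub.
apply: (measurability (@RGenOInfty.G R)) => [|/= _ [_] [r] -> <-].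
  exact: RGenOInfty.measurableE.
rewrite setTI -[X in measurable X]setCK; apply: measurableC.
apply: is_interval_measurable => x y /=.
rewrite !in_itv/= !andbT => /negP; rewrite -leNgt => fx /negP.
rewrite -leNgt => fy z /andP[xz zy]; rewrite in_itv/= andbT; apply/negP.
rewrite -leNgt.
have := sub z x; have := sub z y.
have [c0|c0] := leP 0 (c z); nra.
Qed.

End convex.

(** * Densities and f-divergences *)

Section density.
Context d (T : measurableType d) (R : realType).
Implicit Types (P Q : probability T R) (g : T -> R).

Lemma dominates_density (P : probability T R)
    (mu : {sigma_finite_measure set T -> \bar R}) : P `<< mu ->
  exists2 g : T -> R, measurable_fun setT g /\ (forall x, 0 <= g x)%R &
    eq_measure P (fun A => \int[mu]_(x in A) (g x)%:E).
Proof.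
move=> Pmu; have [g [g0 gfin gint gE]] := radon_nikodym_sigma_finite Pmu.
exists (fine \o g).
  split; last by move=> x; exact: fine_ge0.
  by apply: measurableT_comp => //; exact: measurable_int gint.
by move=> A mA; rewrite gE//; apply: eq_integral => x _; rewrite /= fineK.
Qed.

Lemma density_dominates (P : {measure set T -> \bar R})
    (mu : {measure set T -> \bar R}) g : measurable_fun setT g ->
  eq_measure P (fun A => \int[mu]_(x in A) (g x)%:E) -> P `<< mu.
Proof.
move=> mg PE; apply/null_content_dominatesP => A mA A0.
by rewrite PE// null_set_integral//; apply/measurable_funTS/measurable_EFinP.
Qed.

(** A zero integral over [A] makes [g] vanish almost everywhere on [A]; as [g] is positive, [A]
    itself is null. *)
Lemma pos_density_dominates (P mu : {measure set T -> \bar R}) g :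
  measurable_fun setT g -> (forall x, 0 < g x)%R ->
  eq_measure P (fun A => \int[mu]_(x in A) (g x)%:E) -> mu `<< P.
Proof.
move=> mg g0 PE; apply/null_content_dominatesP => A mA PA0.
have int0 := etrans (esym (PE _ mA)) PA0.
have mgA : measurable_fun A (EFin \o g).
  exact/measurable_funTS/measurable_EFinP.
have : \int[mu]_(x in A) `|(EFin \o g) x| = 0.
  by rewrite -[RHS]int0; apply: eq_integral => x _; rewrite /= ger0_norm// ltW.
move/(ae_eq_integral_abs _ mA mgA) => [N [mN N0 AN]].
apply: (subset_measure0 mA mN _ N0) => x Ax; apply: AN => /= /(_ Ax)[].
by apply/eqP; rewrite gt_eqF.
Qed.

Lemma density_ae_eq (P Q : probability T R) g : measurable_fun setT g ->
  (forall x, 0 <= g x)%R ->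
  eq_measure P (fun A => \int[Q]_(x in A) (g x)%:E) ->
  forall D, measurable D ->
  ae_eq Q D (Radon_Nikodym_SigmaFinite.f P Q) (EFin \o g).
Proof.
move=> mg g0 PE D mD; have PQ := density_dominates mg PE.
apply: integral_ae_eq => //.
- apply: (integrableS measurableT) => //.
  exact: Radon_Nikodym_SigmaFinite.f_integrable.
- exact/measurable_funTS/measurable_EFinP.
- move=> E ED mE; rewrite -Radon_Nikodym_SigmaFinite.f_integral//; exact: PE.
Qed.

Lemma ge0_integral_density (P Q : probability T R) g (k : T -> R) D :
  measurable_fun setT g -> (forall x, 0 <= g x)%R ->
  eq_measure P (fun A => \int[Q]_(x in A) (g x)%:E) ->
  measurable D -> measurable_fun setT k -> (forall x, 0 <= k x)%R ->
  \int[Q]_(x in D) (k x * g x)%:E = \int[P]_(x in D) (k x)%:E.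
Proof.
move=> mg g0 PE mD mk k0; have PQ := density_dominates mg PE.
have mkD : measurable_fun D (EFin \o k) by exact/measurable_funTS/measurable_EFinP.
rewrite -[RHS](Radon_Nikodym_SigmaFinite.change_of_variables PQ (f := EFin \o k))//.
apply: ae_eq_integral => //.
- by apply/measurable_funTS/measurable_EFinP; exact: measurable_funM.
- apply: emeasurable_funM => //; apply: measurable_funTS.
  exact: measurable_int (Radon_Nikodym_SigmaFinite.f_integrable _).
have := density_ae_eq mg g0 PE mD; apply: filterS => x /= h Dx.
by rewrite h.
Qed.

(** [Radon_Nikodym_SigmaFinite.f] is the link: it agrees almost everywhere with [g] and with the
    derivative used in the definition. *)
Lemma fdivergence_density (f : R -> R) (P Q : probability T R) g :
  measurable_fun setT f -> measurable_fun setT g -> (forall x, 0 <= g x)%R ->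
  eq_measure P (fun A => \int[Q]_(x in A) (g x)%:E) ->
  fdivergence f P Q = \int[Q]_x (f (g x))%:E.
Proof.
move=> mf mg g0 PE; have PQ := density_dominates mg PE.
apply: ae_eq_integral => //.
- apply/measurable_EFinP; apply: (measurableT_comp mf).
  exact: measurableT_comp.
- by apply/measurable_EFinP; exact: measurableT_comp.
have h1 := density_ae_eq mg g0 PE measurableT.
have h2 := ae_eq_Radon_Nikodym_SigmaFinite PQ measurableT.
apply: filterS2 h1 h2 => x /= h1 h2 _.
by rewrite -h2// h1.
Qed.

(** Meant for divergences, where the integral of [F] may be [+oo]; both sides are then [+oo]. *)
Lemma ge0_integrable_integralD (mu : {measure set T -> \bar R}) (F G : T -> R) :
  measurable_fun setT F -> (forall x, 0 <= F x)%R ->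
  mu.-integrable setT (EFin \o G) ->
  \int[mu]_x (F x + G x)%:E = \int[mu]_x (F x)%:E + \int[mu]_x (G x)%:E.
Proof.
move=> mF F0 iG; have mEF : measurable_fun setT (EFin \o F) by exact/measurable_EFinP.
have mEG : measurable_fun setT (EFin \o G) by exact: measurable_int iG.
have Gfin : \int[mu]_x (G x)%:E \is a fin_num by exact: integrable_fin_num iG.
have [Fy|Fy] := eqVneq (\int[mu]_x (F x)%:E) +oo; last first.
  rewrite -integralD//; apply/integrableP; split => //.
  under eq_integral do rewrite /= ger0_norm//.
  by rewrite ltey.
rewrite Fy addye; last by rewrite gt_eqF// ltNye_eq Gfin.
have mFG : measurable_fun setT (fun x => (F x + G x)%:E).
  by apply/measurable_EFinP; apply: measurable_funD => //; exact/measurable_EFinP.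
have mG : measurable_fun setT G by exact/measurable_EFinP.
have abG : \int[mu]_x `|(G x)%:E| < +oo by have /integrableP[] := iG.
rewrite integralE.
set p := \int[mu]_x _; set q := \int[mu]_x _.
(* The negative part of [F + G] is at most the absolute value of [G]. *)
have q_fin : q \is a fin_num.
  rewrite ge0_fin_numE; last by apply: integral_ge0.
  apply: le_lt_trans abG; apply: ge0_le_integral => //.
  - exact: measurable_funeneg.
  - exact: measurableT_comp.
  move=> x _; rewrite funenegE /= -EFin_max lee_fin ge_max normr_ge0 andbT.
  by have := ler_norm (- G x)%R; rewrite normrN; have := F0 x; lra.
(* [F] is at most the positive part of [F + G] plus the absolute value of [G], so that positive part
   cannot have a finite integral. *)
have -> : p = +oo.
  apply/eqP; rewrite -leye_eq leNgt; apply/negP => p_fin.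
  have : p + \int[mu]_x `|(G x)%:E| < +oo by exact: lte_add_pinfty.
  apply/negP; rewrite -leNgt -[leLHS]Fy -ge0_integralD//; last 2 first.
  - exact: measurable_funepos.
  - exact: measurableT_comp.
  apply: ge0_le_integral => //.
  - by move=> x _; rewrite lee_fin.
  - by apply: emeasurable_funD; [exact: measurable_funepos|exact: measurableT_comp].
  move=> x _; rewrite funeposE /= -EFin_max lee_fin.
  have := ler_norm (- G x)%R; rewrite normrN => G_le.
  have : (F x + G x <= Num.max (F x + G x) 0)%R by rewrite le_max lexx.
  lra.
by rewrite addye//; case: q q_fin => // r.
Qed.

End density.

(** * Change of variables along a pushforward *)

Section integral_eq_pushforward.
Context d1 d2 (X : measurableType d1) (Y : measurableType d2) (R : realType).
Variables (nu : probability X R) (beta : probability Y R) (phi : X -> Y).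
Hypotheses (mphi : measurable_fun setT phi)
           (nubeta : eq_measure (pushforward nu phi) beta).

Lemma ge0_integral_eq_pushforward D (F : Y -> \bar R) :
  measurable D -> measurable_fun D F -> (forall y, 0 <= F y) ->
  \int[beta]_(y in D) F y = \int[nu]_(x in phi @^-1` D) F (phi x).
Proof.
move=> mD mF F0.
rewrite (@eq_measure_integral _ _ _ D (pushforward nu phi) beta).
  by rewrite ge0_integral_pushforward.
by move=> A mA _; exact/esym/nubeta.
Qed.

Lemma integral_eq_pushforward (F : Y -> \bar R) : measurable_fun setT F ->
  \int[beta]_y F y = \int[nu]_x F (phi x).
Proof.
move=> mF; rewrite integralE [RHS]integralE.
congr (_ - _); rewrite ge0_integral_eq_pushforward//.
- by apply: eq_integral => x _; rewrite !funeposE.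
- exact: measurable_funepos.
- by apply: eq_integral => x _; rewrite !funenegE.
- exact: measurable_funeneg.
Qed.

Lemma dominates_eq_pushforward (alpha : probability X R) (mu : probability Y R) :
  eq_measure (pushforward alpha phi) mu -> alpha `<< nu -> mu `<< beta.
Proof.
move=> amu /null_content_dominatesP anu; apply/null_content_dominatesP => A mA A0.
rewrite -[LHS](amu A mA); apply: anu; first exact: measurable_preimageT.
by rewrite -[RHS]A0; exact: nubeta.
Qed.

End integral_eq_pushforward.

(** * Divergences upstairs and downstairs *)

Section fdivergence_pushforward.
Context d1 d2 (X : measurableType d1) (Y : measurableType d2) (R : realType).
Variables (nu : probability X R) (beta : probability Y R) (phi : X -> Y).
Hypotheses (mphi : measurable_fun setT phi)
           (nubeta : eq_measure (pushforward nu phi) beta).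

Lemma fdivergence_lift (f : R -> R) (mu : probability Y R) :
  measurable_fun setT f -> mu `<< beta ->
  exists alpha : probability X R,
    [/\ alpha `<< nu, eq_measure (pushforward alpha phi) mu &
        fdivergence f alpha nu = fdivergence f mu beta].
Proof.
move=> mf mubeta.
have [g [mg g0] gE] := dominates_density mubeta.
have mgp : measurable_fun setT (g \o phi) by exact: measurableT_comp.
(* The lifted measure has a density constant on the fibres of [phi], so no divergence is added along
   them. *)
pose a A := \int[nu]_(x in A) (g (phi x))%:E.
have phiE A : measurable A -> a (phi @^-1` A) = mu A.
  move=> mA; rewrite /a gE// (ge0_integral_eq_pushforward mphi nubeta mA)//.
  exact/measurable_funTS/measurable_EFinP.
have a0 : a set0 = 0 by rewrite /a integral_set0.
have a_ge0 A : 0 <= a A by apply: integral_ge0 => x _; rewrite lee_fin.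
have a_sigma : semi_sigma_additive a.
  apply: semi_sigma_additive_nng_induced; first exact/measurable_EFinP.
  by move=> x; rewrite lee_fin.
have aM := isMeasure.Build _ _ _ a a0 a_ge0 a_sigma.
pose am : {measure set X -> \bar R} := HB.pack a aM.
have am1 : am setT = 1 by rewrite -(preimage_setT phi) [LHS]phiE// probability_setT.
have [alpha alphaE] := measure_probability am1.
have alpha_g : eq_measure alpha (fun A => \int[nu]_(x in A) ((g \o phi) x)%:E).
  by move=> A mA; rewrite alphaE.
exists alpha; split.
- exact: (density_dominates mgp alpha_g).
- by move=> A mA; rewrite /pushforward alphaE; exact: phiE.
rewrite (fdivergence_density mf mgp (fun x => g0 (phi x)) alpha_g).
rewrite (fdivergence_density mf mg g0 gE).
rewrite (integral_eq_pushforward mphi nubeta)//; apply/measurable_EFinP.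
exact: measurableT_comp.
Qed.

Lemma le_fdivergence_pushforward (f : R -> R) (alpha : probability X R)
    (mu : probability Y R) : convex_function [set: R^o] f ->
  eq_measure (pushforward alpha phi) mu -> alpha `<< nu ->
  fdivergence f mu beta <= fdivergence f alpha nu.
Proof.
move=> cf amu anu.
have [c c_nd sub] := convex_function_subgradient cf.
have mf := subgradient_measurable sub.
have [r [mr r0] rE] := dominates_density anu.
have [g [mg g0] gE] := dominates_density (dominates_eq_pushforward mphi nubeta amu anu).
rewrite (fdivergence_density mf mr r0 rE) (fdivergence_density mf mg g0 gE).
(* subtracting the tangent at [1] makes all the integrands nonnegative *)
pose h t := (f t - (f 1 + c 1 * (t - 1)))%R.
pose k t := (c t - c 1)%R.
have h_ge0 t : (0 <= h t)%R by rewrite /h subr_ge0.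
have h_sub s t : (h s + k s * (t - s) <= h t)%R.
  by rewrite /h /k; have := sub s t; nra.
have k_nd : {homo k : x y / (x <= y)%R} by move=> x y xy; rewrite lerD2r c_nd.
have mh : measurable_fun setT h := subgradient_measurable h_sub.
have mk : measurable_fun setT k by exact: nondecreasing_measurable.
(* A density [q] has integral 1, so the tangent at 1 integrates to [f 1]: both divergences are
   shifted by the same finite constant. *)
have tangent d (T : measurableType d) (P Q : probability T R) (q : T -> R) :
    measurable_fun setT q -> (forall x, 0 <= q x)%R ->
    eq_measure P (fun A => \int[Q]_(x in A) (q x)%:E) ->
    \int[Q]_x (f (q x))%:E = \int[Q]_x (h (q x))%:E + (f 1)%:E.
  move=> mq q0 qE; have q1 : \int[Q]_x (q x)%:E = 1.
    by rewrite -(qE _ measurableT) probability_setT.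
  have iq : Q.-integrable setT (EFin \o q).
    apply/integrableP; split; first exact/measurable_EFinP.
    under eq_integral do rewrite /= ger0_norm//.
    by rewrite q1 ltry.
  have i1 := finite_measure_integrable_cst Q (f 1 - c 1)%R measurableT.
  have i2 := integrableZl measurableT (c 1%R) iq.
  pose G x := ((f 1 - c 1) + c 1 * q x)%R.
  rewrite (_ : \int[Q]_x (f (q x))%:E = \int[Q]_x (h (q x) + G x)%:E).
    rewrite ge0_integrable_integralD//.
    - congr (_ + _); transitivity (\int[Q]_x
          ((EFin \o cst (f 1 - c 1)%R) x + (c 1%R)%:E * (EFin \o q) x)) => //.
      rewrite integralD// integralZl// q1 mule1.
      rewrite (integral_cst Q measurableT (f 1 - c 1)%:E).
      rewrite [X in _ * X](_ : _ = 1); last exact: probability_setT.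
      by rewrite mule1 -EFinD subrK.
    - exact: measurableT_comp.
    - rewrite (_ : EFin \o G = (EFin \o cst (f 1 - c 1)%R) \+
          (fun x => (c 1%R)%:E * (EFin \o q) x)); first exact: integrableD.
      by apply/funext => x; rewrite /G/= EFinD EFinM.
  by apply: eq_integral => x _; congr EFin; rewrite /h /G; ring.
rewrite (tangent _ _ _ _ _ mr r0 rE) (tangent _ _ _ _ _ mg g0 gE) leeD2r//.
(* Truncation to bounded [g] also bounds [k \o g], so that the integrals of the linear terms are
   finite and can be cancelled. *)
pose B n := [set y | (g y <= n%:R)%R].
have mB n : measurable (B n).
  rewrite (_ : B n = g @^-1` `]-oo, n%:R]); first exact: measurable_preimageT.
  by apply/seteqP; split => y; rewrite /B/= in_itv.
pose E n := phi @^-1` B n.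
have mE n : measurable (E n) by exact: measurable_preimageT.
have mpsiphi (psi : Y -> R) : measurable_fun setT psi ->
    measurable_fun setT (psi \o phi) by move=> mpsi; exact: measurableT_comp.
(* [g \o phi] acts as the conditional expectation of [r] given [phi]: both sides are the integral of
   [psi] over [B n] under [mu]. *)
have exchange (psi : Y -> R) n : measurable_fun setT psi -> (forall y, 0 <= psi y)%R ->
    \int[nu]_(x in E n) (psi (phi x) * r x)%:E =
    \int[nu]_(x in E n) (psi (phi x) * g (phi x))%:E.
  move=> mpsi psi0.
  rewrite (ge0_integral_density mr r0 rE (mE n) (mpsiphi _ mpsi))//.
  have mpsiE : measurable_fun setT (EFin \o psi) by exact/measurable_EFinP.
  rewrite -(ge0_integral_eq_pushforward mphi amu (mB n) (measurable_funTS mpsiE))//.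
  rewrite -(ge0_integral_density mg g0 gE (mB n) mpsi)//.
  rewrite (ge0_integral_eq_pushforward mphi nubeta (mB n))//.
    by apply/measurable_funTS/measurable_EFinP; exact: measurable_funM.
    by move=> y; rewrite lee_fin mulr_ge0.
  by move=> x; exact: psi0.
have leB n : \int[beta]_(y in B n) (h (g y))%:E <= \int[nu]_x (h (r x))%:E.
  have mhg : measurable_fun setT (h \o g) by exact: measurableT_comp.
  have mkg : measurable_fun setT (k \o g) by exact: measurableT_comp.
  have mgp := mpsiphi _ mg.
  rewrite (ge0_integral_eq_pushforward mphi nubeta (mB n))//; last 2 first.
    exact/measurable_funTS/measurable_EFinP.
    by move=> y; rewrite lee_fin.
  (* The slope [k \o g] is split into positive and negative parts, since [exchange] is about
     nonnegative functions. *)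
  pose kp y := (Num.max (k (g y)) 0)%R.
  pose km y := (Num.max (- k (g y)) 0)%R.
  have mkp : measurable_fun setT kp by exact: measurable_maxr.
  have mkm : measurable_fun setT km.
    by apply: measurable_maxr => //; exact: measurable_funN.
  have kp0 y : (0 <= kp y)%R by rewrite le_max lexx orbT.
  have km0 y : (0 <= km y)%R by rewrite le_max lexx orbT.
  (* On [B n] the values of [g] lie between 0 and [n]; as [k] is monotone, the sum bounds both parts
     of [k \o g], and the last factor bounds [g]. *)
  pose C := ((`|k n%:R| + `|k 0|) * n%:R)%R.
  have lt_inf (psi : Y -> R) : measurable_fun setT psi ->
      (forall y, 0 <= psi y)%R ->
      (forall y, B n y -> psi y <= `|k n%:R| + `|k 0|)%R ->
      \int[nu]_(x in E n) (psi (phi x) * g (phi x))%:E < +oo.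
    move=> mpsi psi0 psiC.
    apply: (@le_lt_trans _ _ (\int[nu]_(x in E n) (cst C%:E) x)).
      apply: ge0_le_integral => //.
      - by move=> x _; rewrite lee_fin mulr_ge0.
      - apply/measurable_funTS/measurable_EFinP.
        by apply: measurable_funM => //; exact: mpsiphi.
      - by move=> x Ex; rewrite lee_fin ler_pM// psiC.
    rewrite integral_cst// -ge0_fin_numE; first by rewrite fin_numM// fin_num_measure.
    by rewrite mule_ge0// lee_fin mulr_ge0// addr_ge0.
  have kB y : B n y -> (k 0 <= k (g y) <= k n%:R)%R.
    by move=> By; rewrite !k_nd.
  have kp_fin := lt_inf _ mkp kp0.
  have km_fin := lt_inf _ mkm km0.
  have {}kp_fin : \int[nu]_(x in E n) (kp (phi x) * g (phi x))%:E < +oo.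
    apply: kp_fin => y /kB/andP[k1 k2]; rewrite ge_max addr_ge0// andbT.
    by have := ler_norm (k n%:R); have := normr_ge0 (k 0%R); lra.
  have {}km_fin : \int[nu]_(x in E n) (km (phi x) * g (phi x))%:E < +oo.
    apply: km_fin => y /kB/andP[k1 k2]; rewrite ge_max addr_ge0// andbT.
    have := ler_norm (- k 0)%R; rewrite normrN.
    by have := normr_ge0 (k n%:R)%R; lra.
  have intM (psi : Y -> R) (q : X -> R) :
      measurable_fun setT psi -> measurable_fun setT q ->
      measurable_fun (E n) (fun x => (psi (phi x) * q x)%:E).
    move=> mpsi mq; apply/measurable_funTS/measurable_EFinP.
    by apply: measurable_funM => //; exact: mpsiphi.
  have mhEn (q : X -> R) : measurable_fun setT q ->
      measurable_fun (E n) (fun x => (h (q x))%:E).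
    move=> mq; apply/measurable_funTS/measurable_EFinP.
    exact: measurableT_comp.
  have split3 (q1 q2 q3 : X -> R) :
      measurable_fun setT q1 -> measurable_fun setT q2 -> measurable_fun setT q3 ->
      (forall x, 0 <= q2 x)%R -> (forall x, 0 <= q3 x)%R ->
      \int[nu]_(x in E n)
        ((h (q1 x))%:E + ((kp (phi x) * q2 x)%:E + (km (phi x) * q3 x)%:E)) =
      \int[nu]_(x in E n) (h (q1 x))%:E +
      (\int[nu]_(x in E n) (kp (phi x) * q2 x)%:E +
       \int[nu]_(x in E n) (km (phi x) * q3 x)%:E).
    move=> mq1 mq2 mq3 q20 q30.
    rewrite ge0_integralD//; first last.
    - by apply: emeasurable_funD; exact: intM.
    - by move=> x _; rewrite adde_ge0// lee_fin mulr_ge0.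
    - exact: mhEn.
    - by move=> x _; rewrite lee_fin.
    congr (_ + _); rewrite ge0_integralD//; first last.
    - exact: intM.
    - by move=> x _; rewrite lee_fin mulr_ge0.
    - exact: intM.
    - by move=> x _; rewrite lee_fin mulr_ge0.
  apply: (@le_trans _ _ (\int[nu]_(x in E n) (h (r x))%:E)); last first.
    apply: ge0_subset_integral => //.
    - by apply/measurable_EFinP; exact: measurableT_comp.
    - by move=> x _; rewrite lee_fin.
  (* After adding this finite quantity and applying [exchange], it remains to integrate [h g + (kp r
     + km g) <= h r + (kp g + km r)], with [g], [kp] and [km] taken at [phi x]: the subgradient
     inequality freed of subtractions. *)
  rewrite -(@leeD2rE _ (\int[nu]_(x in E n) (kp (phi x) * g (phi x))%:E +
    \int[nu]_(x in E n) (km (phi x) * g (phi x))%:E)); last first.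
    rewrite ge0_fin_numE; first exact: lte_add_pinfty.
    by apply: adde_ge0; apply: integral_ge0 => x _; rewrite lee_fin mulr_ge0.
  rewrite -[X in _ + (X + _) <= _](exchange _ _ mkp kp0).
  rewrite -[X in _ <= _ + (_ + X)](exchange _ _ mkm km0).
  rewrite -!split3//; apply: ge0_le_integral => //.
  - by move=> x _; rewrite !adde_ge0// lee_fin// mulr_ge0.
  - by do !apply: emeasurable_funD; [exact: mhEn|exact: intM|exact: intM].
  - by do !apply: emeasurable_funD; [exact: mhEn|exact: intM|exact: intM].
  move=> x _; rewrite -!EFinD lee_fin.
  have := h_sub (g (phi x)) (r x).
  have -> : k (g (phi x)) = (kp (phi x) - km (phi x))%R.
    by rewrite /kp /km; have [?|?] := leP (k (g (phi x))) 0%R;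
      have [?|?] := leP (- k (g (phi x)))%R 0%R; lra.
  by rewrite mulrBl !mulrBr; lra.
(* Monotone convergence along the increasing sets [B n] removes the truncation. *)
have BT : \bigcup_n B n = setT.
  apply/seteqP; split => // y _; exists (Num.truncn (g y)).+1 => //.
  by rewrite /B/= ltW// truncnS_gt.
have mhg : measurable_fun setT (fun y => (h (g y))%:E).
  by apply/measurable_EFinP; exact: measurableT_comp.
have ndB : nondecreasing_seq B.
  move=> i j ij; apply/subsetPset => y /= /le_trans; apply.
  by rewrite ler_nat.
have := ge0_nondecreasing_set_cvg_integral (mu := beta) ndB mB
  (fun i => measurable_funTS mhg) (fun i y _ => h_ge0 (g y)).
rewrite BT => cvgB; rewrite -(cvg_lim _ cvgB)//; apply: lime_le.
  by apply/cvg_ex; eexists; exact: cvgB.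
exact: nearW.
Qed.

End fdivergence_pushforward.

Theorem theoremI2 (R : realType) (m n : nat) (hmn : (m <= n)%N) :
  (forall p : \bar R, 1 <= p ->
    forall (mu : probability (Rn R m) R) (nu : probability (Rn R n) R),
    finite_moment p mu -> finite_moment p nu ->
    ereal_inf [set wasserstein p mu beta | beta in projections nu m] =
    ereal_inf [set wasserstein p alpha nu | alpha in embeddings_moment p mu n])
  /\
  (forall f : R -> R, convex_function [set: R^o] f -> f 1%R = 0%R ->
    forall (mu : probability (Rn R m) R) (nu : probability (Rn R n) R),
    has_density mu -> has_pos_density nu ->
    ereal_inf [set fdivergence f mu beta | beta in projections nu m] =
    ereal_inf [set fdivergence f alpha nu | alpha in embeddings_density mu n]).
Proof.
split=> [p p1 mu nu fmu fnu|f cf _ mu nu [gmu [_ [mgmu muE]]]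
    [gnu [gnu0 [mgnu nuE]]]]; apply/eqP; rewrite eq_le; apply/andP; split.
(* The map that projects [alpha] to [mu] also projects [nu], which gives the competitor [beta]. *)
- apply: le_ereal_inf_tmp => _ [alpha [_ [V [b [VV amu]]]] <-].
  have [beta betaE] := pushforward_probability nu (measurable_affine_Rn V b).
  have nbeta : eq_measure (pushforward nu (affine_Rn V b)) beta by rewrite betaE.
  apply: ge_ereal_inf; exists (wasserstein p mu beta).
    by exists beta => //; exists V, b.
  exact: wasserstein_affine_Rn nbeta.
- apply: le_ereal_inf_tmp => _ [beta [V [b [VV nbeta]]] <-].
  rewrite wassersteinE//; apply: le_ereal_inf_tmp => _ [gamma cgamma <-].
  (* The slack [e] absorbs the mesh of the partition used for gluing. *)
  apply/lee_addgt0Pr => e e0.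
  have [alpha ealpha le_alpha] := coupling_embedding p1 VV fmu fnu nbeta cgamma e0.
  by apply: ge_ereal_inf; exists (wasserstein p alpha nu) => //; exists alpha.
- apply: le_ereal_inf_tmp => _ [alpha [[g [_ [mg gE]]] [V [b [VV amu]]]] <-].
  have [beta betaE] := pushforward_probability nu (measurable_affine_Rn V b).
  have nbeta : eq_measure (pushforward nu (affine_Rn V b)) beta by rewrite betaE.
  apply: ge_ereal_inf; exists (fdivergence f mu beta).
    by exists beta => //; exists V, b.
  apply: (le_fdivergence_pushforward (measurable_affine_Rn V b) nbeta cf amu).
  (* Domination passes through Lebesgue measure, which [nu] dominates because its density is
     positive. *)
  apply: null_dominates_trans (density_dominates mg gE) _.
  exact: pos_density_dominates mgnu gnu0 nuE.
apply: le_ereal_inf_tmp => _ [beta [V [b [VV nbeta]]] <-].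
have [c _ sub] := convex_function_subgradient cf.
(* A [beta]-null set has a [nu]-null, hence Lebesgue-null, preimage; so it is itself Lebesgue-null,
   and [mu]-null as [mu] has a density. *)
have mubeta : mu `<< beta.
  apply/null_content_dominatesP => A mA A0.
  have mphi := measurable_affine_Rn V b.
  have /null_content_dominatesP muleb := density_dominates mgmu muE.
  have /null_content_dominatesP lebnu := pos_density_dominates mgnu gnu0 nuE.
  apply: muleb => //; apply: (lebesgue_Rn_affine_null (b := b) VV mA).
  apply: lebnu; first exact: measurable_preimageT.
  exact: etrans (nbeta A mA) A0.
have [alpha [anu amu <-]] := fdivergence_lift (measurable_affine_Rn V b) nbeta
  (subgradient_measurable sub) mubeta.
apply: ge_ereal_inf; exists (fdivergence f alpha nu) => //; exists alpha => //.
split; last by exists V, b.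
(* [alpha] has a Lebesgue density, since it is dominated by [nu], which has one. *)
have [g [mg g0] gE] := dominates_density
  (null_dominates_trans anu (density_dominates mgnu nuE)).
by exists g.
Qed.
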